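(* Consider the fully locally controllable two-qubit system (qubit S, ancilla B) with Hamiltonian $H$ and coupling strength $J>0$ described in the context. Let the initial state be $\rho(0)=\tfrac12\mathbb 1_{\mathrm S}\otimes\rho_{\mathrm B}(0)$ (qubit maximally mixed), where $\rho_{\mathrm B}(0)\neq\tfrac12\mathbb 1_{\mathrm B}$ is a $2\times2$ density matrix. Then the minimum time to reset the qubit, i.e. to reach from this state the maximum possible qubit purity $\mathrm{tr}\{\rho_{\mathrm S}'^{\,2}\}$, $\rho_{\mathrm S}'=\mathrm{tr}_{\mathrm B}\{U_{\mathrm F}\rho(0)U_{\mathrm F}^\dagger\}$, over all $U_{\mathrm F}\in\mathrm{SU}(4)$, is $$T_{\min}=\frac{\pi}{2J}.$$ The time-optimal control strategies correspond to the cases where, in $U_{\mathrm F}=K\,e^{\frac i2\sum_{k=1}^3c_k\sigma_k\otimes\sigma_k}K'$, two of the $c_k$ are equal to $\pi/2$ and the third one is zero. The control protocol depends on the local operation on the ancilla, characterized by the parameters $p_{\mathrm B}^{\mathrm g\prime},p_{\mathrm B}^{\mathrm e\prime},\gamma_{\mathrm B}'$ (defined in the context), and is optimized to attain maximum purity.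
   Context: $\sigma_1,\sigma_2,\sigma_3$ are the Pauli matrices; $\mathrm{tr}_{\mathrm B}$ is the partial trace over the second tensor factor of $\mathbb C^2\otimes\mathbb C^2$. Control system: $H=H_{\mathrm S}\otimes\mathbb 1_{\mathrm B}+\mathbb 1_{\mathrm S}\otimes H_{\mathrm B}+H_{\mathrm{int}}$, with $H_{\mathrm S}=\sum_{i=1}^3u_{i,\mathrm S}\sigma_i$, $H_{\mathrm B}=\sum_{i=1}^3u_{i,\mathrm B}\sigma_i$ and $H_{\mathrm{int}}=J\,\sigma_m\otimes\sigma_l$ for some fixed $m,l\in\{1,2,3\}$, where $J$ is a constant. No limit is imposed on the control fields $u_{i,\mathrm S},u_{i,\mathrm B}$, so any local operation (element of $\mathrm{SU}(2)\otimes\mathrm{SU}(2)$) can be realized in negligible time. Minimum time to generate a unitary (Time-Optimal Tori Theorem of Khaneja et al., taken as given): the minimum time to generate $U_{\mathrm F}\in\mathrm{SU}(4)$ is $T=\frac1{2J}\sum_kc_k$, for the smallest value of $\sum_kc_k$ with $c_k\in[0,\pi]$ such that $U_{\mathrm F}=K\,e^{\frac i2\sum_{k=1}^3c_k\sigma_k\otimes\sigma_k}K'$ for some $K,K'\in\mathrm{SU}(2)\otimes\mathrm{SU}(2)$. Parameters: writing $k_{\mathrm B}$ for the ancilla factor of $K'$, the numbers $p_{\mathrm B}^{\mathrm e\prime},p_{\mathrm B}^{\mathrm g\prime}$ are the upper and lower diagonal entries, and $\gamma_{\mathrm B}'$ the upper off-diagonal entry, of the locally transformed initial ancilla state $k_{\mathrm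 B}\,\rho_{\mathrm B}(0)\,k_{\mathrm B}^\dagger$. *)

(* Defs.v *)
From HB Require Import structures.
From mathcomp Require Import all_boot all_order all_algebra.
From mathcomp Require Import all_classical all_reals all_analysis.
From mathcomp Require Import complex mxtens.
Set Implicit Arguments.
Unset Strict Implicit.
Unset Printing Implicit Defensive.
Import Order.TTheory GRing.Theory Num.Theory.
Import numFieldNormedType.Exports.
Local Open Scope classical_set_scope.
Local Open Scope complex_scope.
Local Open Scope sesquilinear_scope.
Local Open Scope ring_scope.

Definition is_minimum (R : realType) (A : set R) (x : R) : Prop :=
  A x /\ lbound A x.

Section TwoQubits.
Variable R : realType.
Local Notation C := R[i].

(* Matrix exponential: limit of the partial sums of sum_k A^k / k!, taken on
   the real and imaginary parts of each entry. *)
Definition mexp n (A : 'M[C]_n) : 'M[C]_n :=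
  \matrix_(i, j)
    let term (k : nat) : C := (A ^+ k) i j / k`!%:R in
    (lim (series (fun k => complex.Re (term k)) @ \oo)
     +i* lim (series (fun k => complex.Im (term k)) @ \oo)).

(* pauli k is sigma_(k+1): indices run over 0, 1, 2. *)
Definition pauli (k : 'I_3) : 'M[C]_2 :=
  \matrix_(a, b)
    match val k with
    | 0%N => (a != b)%:R
    | 1%N => if a == b then 0 else if a == 0 then - 'i%C else 'i%C
    | _ => if a != b then 0 else if a == 0 then 1 else -1
    end.

Definition SU n (U : 'M[C]_n) : Prop := U \is unitarymx /\ \det U = 1.

(* SU(2) (x) SU(2); the first tensor factor is the qubit S, the second is the
   ancilla B, as everywhere below. *)
Definition local_op (K : 'M[C]_(2 * 2)) : Prop :=
  exists kS kB : 'M[C]_2, [/\ SU kS, SU kB & K = kS *t kB].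

(* Nonnegativity of a complex number includes it being real, so positive
   semidefiniteness forces rho to be Hermitian. *)
Definition density_matrix n (rho : 'M[C]_n) : Prop :=
  (forall v : 'cV[C]_n, 0 <= (v ^t* *m rho *m v) 0 0) /\ \tr rho = 1.

Definition ptraceB (M : 'M[C]_(2 * 2)) : 'M[C]_2 :=
  \matrix_(a, b) \sum_(k < 2) M (mxtens_index (a, k)) (mxtens_index (b, k)).

Definition initial_state (rhoB : 'M[C]_2) : 'M[C]_(2 * 2) :=
  (2^-1 *: 1%:M) *t rhoB.

Definition final_qubit_state (rhoB : 'M[C]_2) (U : 'M[C]_(2 * 2)) : 'M[C]_2 :=
  ptraceB (U *m initial_state rhoB *m U ^t*).

(* For a density matrix rhoB the trace is real: Re only changes the type. *)
Definition qubit_purity (rhoB : 'M[C]_2) (U : 'M[C]_(2 * 2)) : R :=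
  let rhoS := final_qubit_state rhoB U in complex.Re (\tr (rhoS *m rhoS)).

Definition resets (rhoB : 'M[C]_2) (U : 'M[C]_(2 * 2)) : Prop :=
  SU U /\ forall V, SU V -> qubit_purity rhoB V <= qubit_purity rhoB U.

Definition hamiltonian (J : R) (m l : 'I_3) (uS uB : 'I_3 -> R) :
    'M[C]_(2 * 2) :=
  (\sum_i (uS i)%:C *: pauli i) *t 1%:M
  + 1%:M *t (\sum_i (uB i)%:C *: pauli i)
  + J%:C *: (pauli m *t pauli l).

(* realizable J m l t U: some control sequence of duration t generates U
   (hbar = 1).  As the fields are unbounded, local operations cost no time;
   in between, the fields are held constant and the system follows the full
   Hamiltonian. *)
Inductive realizable (J : R) (m l : 'I_3) : R -> 'M[C]_(2 * 2) -> Prop :=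
| realizable_start : realizable J m l 0 1%:M
| realizable_local t U K :
    realizable J m l t U -> local_op K -> realizable J m l t (K *m U)
| realizable_evolve t U s uS uB :
    realizable J m l t U -> 0 <= s ->
    realizable J m l (t + s)
      (mexp ((- 'i%C * s%:C) *: hamiltonian J m l uS uB) *m U).

Definition canonical_gate (c : 'I_3 -> R) : 'M[C]_(2 * 2) :=
  mexp (('i%C / 2) *: \sum_k (c k)%:C *: (pauli k *t pauli k)).

Definition angle_range (c : 'I_3 -> R) : Prop := forall k, 0 <= c k <= pi.

Definition has_angles (U : 'M[C]_(2 * 2)) (c : 'I_3 -> R) : Prop :=
  angle_range c /\
  exists K K', [/\ local_op K, local_op K' & U = K *m canonical_gate c *m K'].

Definition smallest_angles (U : 'M[C]_(2 * 2)) (c : 'I_3 -> R) : Prop :=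
  has_angles U c /\
  forall c', has_angles U c' -> \sum_k c k <= \sum_k c' k.

(* tori_time J T U: T is the minimum time to generate U, as given by the
   time-optimal tori theorem of Khaneja et al.  It is a relation because
   strict SU(4) decompositions with angles in [0, pi] need not exist for every
   U: central phases +-i are not local operations. *)
Definition tori_time (J T : R) (U : 'M[C]_(2 * 2)) : Prop :=
  exists2 c, smallest_angles U c & T = (2 * J)^-1 * \sum_k c k.

Definition reset_times (generates : R -> 'M[C]_(2 * 2) -> Prop)
    (rhoB : 'M[C]_2) : set R :=
  [set T | exists U, resets rhoB U /\ generates T U].

Definition two_half_pi (c : 'I_3 -> R) : Prop :=
  exists j, c j = 0 /\ forall k, k != j -> c k = pi / 2.

(* (p_B^e', p_B^g', gamma_B') *)
Definition ancilla_params (rhoB kB : 'M[C]_2) : C * C * C :=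
  let rhoB' := kB *m rhoB *m kB ^t* in (rhoB' 0 0, rhoB' 1 1, rhoB' 0 1).

End TwoQubits.

(* Main.v *)
(* Write rho_B = 1/2 + r with r traceless and Hermitian, r^2 = x^2 and x > 0.  For
   a unitary U put X = U (1 (x) r) U^* and let 2 m be its partial trace; the purity
   is 1/2 + tr m^2, and the squared Frobenius distance from X to m (x) 1 is
   4 x^2 - 2 tr m^2.  Hence U resets the qubit iff X = m (x) 1: the operator r of
   the ancilla is transferred to the qubit.

   For a gate K e^(i/2 sum c_k sigma_k (x) sigma_k) K' the Bloch vector y of
   r' = k_B r k_B^* becomes (y_j sin c_p sin c_q)_j, {j, p, q} = {1, 2, 3}.  A
   transfer preserves the norm, so sin^2 c_p sin^2 c_q = 1 for some j: two angles
   are pi/2, the sum of the angles is at least pi, with equality iff the third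
   one is 0; and any third index j is allowed once k_B turns r into x sigma_j.

   The bound for realizable gates is a quantum speed limit.  Let L be the local
   unitary generated by the local fields alone.  The vector U^* L w moves at
   speed J, because the coupling is J times an involution, so its angle with w is
   at most J T.  If U transfers r to m, choose w = a (x) b with r b = x b and
   L (a (x) b) an eigenvector of m (x) 1 with eigenvalue - x.  Then U w and L w are
   eigenvectors of m (x) 1 with opposite eigenvalues, hence orthogonal, and
   pi/2 <= J T. *)
Require Import Defs.
From HB Require Import structures.
From mathcomp Require Import all_boot all_order all_algebra.
From mathcomp Require Import all_classical all_reals all_analysis.
From mathcomp Require Import complex mxtens ring lra.
Set Implicit Arguments.
Unset Strict Implicit.
Unset Printing Implicit Defensive.
Import Order.TTheory GRing.Theory Num.Theory.
Import numFieldNormedType.Exports.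
Local Open Scope classical_set_scope.
Local Open Scope complex_scope.
Local Open Scope sesquilinear_scope.
Local Open Scope ring_scope.

(** * Matrix exponentials of skew-Hermitian matrices *)

Section Phases.
Variable R : realType.
Local Notation C := R[i].

Definition cis (x : R) : C := cos x +i* sin x.

Lemma cis0 : cis 0 = 1.
Proof. by rewrite /cis cos0 sin0. Qed.

Lemma cisD x y : cis (x + y) = cis x * cis y.
Proof.
by rewrite /cis cosD sinD; apply/eqP; rewrite eq_complex /= eqxx /= addrC.
Qed.

Lemma conj_cis x : (cis x)^* = cis (- x).
Proof. by rewrite /cis cosN sinN. Qed.

Lemma cis_sum n (f : 'I_n -> R) : cis (\sum_i f i) = \prod_i cis (f i).
Proof. by apply: (big_morph cis cisD cis0). Qed.

Lemma ReD (x y : C) : complex.Re (x + y) = complex.Re x + complex.Re y.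
Proof. by case: x => ? ?; case: y => ? ?. Qed.

Lemma ImD (x y : C) : complex.Im (x + y) = complex.Im x + complex.Im y.
Proof. by case: x => ? ?; case: y => ? ?. Qed.

Lemma Re_sum (I : Type) (s : seq I) (F : I -> C) :
  complex.Re (\sum_(i <- s) F i) = \sum_(i <- s) complex.Re (F i).
Proof. by apply: (big_morph _ ReD). Qed.

Lemma Im_sum (I : Type) (s : seq I) (F : I -> C) :
  complex.Im (\sum_(i <- s) F i) = \sum_(i <- s) complex.Im (F i).
Proof. by apply: (big_morph _ ImD). Qed.

(** The parity of [k] decides whether the [k]-th power of [i] is real or imaginary, so even terms
    feed the cosine series and odd ones the sine series. *)
Lemma iexp_coeff (x : R) k :
  ('i%C * x%:C) ^+ k / k`!%:R = cos_coeff x k +i* sin_coeff x k.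
Proof.
have fE : (k`!%:R : C)^-1 = ((k`!%:R)^-1)%:C.
  by rewrite fmorphV rmorph_nat.
rewrite exprMn -rmorphXn fE -mulrA -rmorphM /=.
have iE : ('i%C : C) ^+ k =
    ((~~ odd k)%:R * (-1) ^+ k./2) +i* ((odd k)%:R * (-1) ^+ k.-1./2).
  rewrite -[in LHS](odd_double_half k) exprD -mul2n exprM sqr_i.
  have -> : (-1 : C) ^+ k./2 = ((-1) ^+ k./2)%:C.
    by rewrite rmorphXn rmorphN rmorph1.
  case ok: (odd k) => /=; last by rewrite mulr0n mulr1n mul0r !mul1r.
  rewrite expr1 mulr0n mulr1n mul0r mul1r.
  have -> : (k.-1./2 = k./2)%N.
    by rewrite -[in LHS](odd_double_half k) ok add1n /= doubleK.
  by simpc.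
rewrite iE; simpc; rewrite /cos_coeff /sin_coeff /=.
by rewrite !mulrA.
Qed.

(** The factor [z] lets one statement serve both components of a matrix entry: the imaginary part of
    [w] is the real part of [- 'i%C * w]. *)
Lemma cvg_Re_iexp (z : C) (x : R) :
  series (fun k => complex.Re (z * (('i%C * x%:C) ^+ k / k`!%:R))) @ \oo
    --> complex.Re (z * cis x).
Proof.
case: z => a b; rewrite [complex.Re (_ * cis x)]/=.
have -> : (fun k => complex.Re ((a +i* b) * (('i%C * x%:C) ^+ k / k`!%:R)))
    = (a *: cos_coeff x - b *: sin_coeff x : nat -> R).
  by apply/funext => k; rewrite iexp_coeff; simpc.
have -> : cos x = lim (series (cos_coeff x) @ \oo) by rewrite unlock.
have -> : sin x = lim (series (sin_coeff x) @ \oo) by rewrite unlock.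
rewrite seriesD seriesN !seriesZ.
apply: cvgB; apply: cvgZr.
  exact: is_cvg_series_cos_coeff.
exact: is_cvg_series_sin_coeff.
Qed.

Lemma cvg_series_sum (I : Type) (s : seq I) (u : I -> nat -> R) (l : I -> R) :
  (forall i, series (u i) @ \oo --> l i) ->
  series (fun k => \sum_(i <- s) u i k) @ \oo --> \sum_(i <- s) l i.
Proof.
move=> ul; elim: s => [|i s IHs].
  rewrite big_nil; set v := series _; have -> : v = cst 0.
    by apply/funext => n; rewrite /v /series /= big1 // => k _; rewrite big_nil.
  exact: cvg_cst.
rewrite big_cons.
have -> : (fun k => \sum_(j <- i :: s) u j k) =
    (u i + (fun k => \sum_(j <- s) u j k) : nat -> R).
  by apply/funext => k; rewrite big_cons.
by rewrite seriesD; apply: cvgD.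
Qed.

Definition phases n (d : 'rV[R]_n) : 'rV[C]_n := map_mx cis d.

Lemma diag_mxX n (d : 'rV[C]_n) k :
  diag_mx d ^+ k = diag_mx (\row_j (d 0 j) ^+ k).
Proof.
elim: k => [|k IHk].
  rewrite expr0; apply/matrixP => i j; rewrite !mxE expr0.
  by case: eqP.
rewrite exprS IHk; apply/matrixP => i j.
rewrite -[_ * _]/(_ *m _) mul_diag_mx !mxE exprS.
by case: eqP => [->|]; rewrite ?mulr1n // !mulr0n mulr0.
Qed.

(** Powers pass through the conjugation, so each entry is a finite combination of scalar exponential
    series. An inverse [Q] rather than an adjoint allows for the Bell matrix, which is unitary only
    up to a scalar. *)
Lemma mexp_diag n (P Q : 'M[C]_n) (d : 'rV[R]_n) : Q *m P = 1%:M ->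
  mexp (P *m diag_mx ('i%C *: map_mx (real_complex R) d) *m Q)
  = P *m diag_mx (phases d) *m Q.
Proof.
move=> QP1; set D := diag_mx _.
have powE k : (P *m D *m Q) ^+ k = P *m (D ^+ k) *m Q.
  elim: k => [|k IHk]; first by rewrite !expr0 mulmx1 (mulmx1C QP1).
  rewrite !exprS IHk -![_ * _]/(_ *m _) !mulmxA.
  by rewrite -(mulmxA _ Q P) QP1 mulmx1.
apply/matrixP => i j; rewrite mxE.
have termE k : ((P *m D *m Q) ^+ k) i j / k`!%:R =
    \sum_l P i l * Q l j * (('i%C * (d 0 l)%:C) ^+ k / k`!%:R).
  rewrite powE diag_mxX mxE big_distrl /=; apply: eq_bigr => l _.
  by rewrite mul_mx_diag !mxE -!mulrA; congr (_ * _); rewrite mulrCA.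
have -> : (P *m diag_mx (phases d) *m Q) i j =
    \sum_l P i l * Q l j * cis (d 0 l).
  rewrite mxE; apply: eq_bigr => l _.
  by rewrite mul_mx_diag !mxE -!mulrA; congr (_ * _); rewrite mulrC.
have ReE (z : C) : z = complex.Re z +i* complex.Im z by case: z.
rewrite [RHS]ReE Re_sum Im_sum; congr (_ +i* _).
  apply: cvg_lim; first exact: Rhausdorff.
  have -> : (fun k => complex.Re (((P *m D *m Q) ^+ k) i j / k`!%:R)) =
      (fun k => \sum_l complex.Re
         (P i l * Q l j * (('i%C * (d 0 l)%:C) ^+ k / k`!%:R))).
    by apply/funext => k; rewrite termE Re_sum.
  by apply: cvg_series_sum => l; apply: cvg_Re_iexp.
have ImE (z : C) : complex.Im z = complex.Re (- 'i%C * z).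
  by case: z => a b; simpc.
apply: cvg_lim; first exact: Rhausdorff.
have -> : (fun k => complex.Im (((P *m D *m Q) ^+ k) i j / k`!%:R)) =
    (fun k => \sum_l complex.Re (- 'i%C * (P i l * Q l j)
        * (('i%C * (d 0 l)%:C) ^+ k / k`!%:R))).
  apply/funext => k; rewrite termE Im_sum; apply: eq_bigr => l _.
  by rewrite ImE; congr complex.Re; rewrite !mulrA.
have -> : \sum_l complex.Im (P i l * Q l j * cis (d 0 l)) =
    \sum_l complex.Re (- 'i%C * (P i l * Q l j) * cis (d 0 l)).
  by apply: eq_bigr => l _; rewrite ImE; congr complex.Re; rewrite !mulrA.
by apply: cvg_series_sum => l; apply: cvg_Re_iexp.
Qed.

(** Spectral theorem, with the eigenvalues kept as a real row so that [phases] applies to them. *)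
Lemma hermitian_diagonal n (A : 'M[C]_n) : A ^t* = A ->
  exists (P : 'M[C]_n) (d : 'rV[R]_n), P \is unitarymx /\
    A = P ^t* *m diag_mx (map_mx (real_complex R) d) *m P.
Proof.
move=> Aherm; have hA : A \is hermsymmx.
  by apply/is_hermitianmxP; rewrite expr0 scale1r Aherm.
have /orthomx_spectralP AE := hermitian_normalmx hA.
have /mxOverP dreal := hermitian_spectral_diag_real hA.
exists (spectralmx A), (\row_j complex.Re (spectral_diag A 0 j)).
split; first exact: spectral_unitarymx.
rewrite [LHS]AE invmx_unitary ?spectral_unitarymx //; congr (_ *m diag_mx _ *m
    _).
by apply/rowP => j; rewrite !mxE RRe_real.
Qed.

Lemma unitarymxV n (U : 'M[C]_n) : U \is unitarymx -> U ^t* *m U = 1%:M.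
Proof. by move=> /unitarymxP /mulmx1C. Qed.

Lemma hermitian_flow n (P : 'M[C]_n) (d : 'rV[R]_n) (s : R) :
  P \is unitarymx ->
  mexp ((- 'i%C * s%:C) *:
        (P ^t* *m diag_mx (map_mx (real_complex R) d) *m P))
  = P ^t* *m diag_mx (phases (- s *: d)) *m P.
Proof.
move=> Pu; rewrite -mexp_diag; last by apply/unitarymxP.
have -> : diag_mx ('i%C *: map_mx (real_complex R) (- s *: d)) =
    (- 'i%C * s%:C) *: diag_mx (map_mx (real_complex R) d).
  apply/matrixP => i j; rewrite !mxE rmorphM rmorphN /=.
  rewrite mulrnAr; congr (_ *+ _); rewrite mulrA; congr (_ * _); ring.
by rewrite -scalemxAr -scalemxAl.
Qed.

End Phases.

(** * The speed of a flow relative to another one *)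

Section TwoDiagonals.
Variables (T : comNzRingType) (n : nat) (P P' Q Q' : 'M[T]_n).
Variables (a : 'rV[T]_n) (b : 'cV[T]_n).
Hypotheses (PP' : P *m P' = 1%:M) (QQ' : Q *m Q' = 1%:M).

(** The coefficient does not involve the eigenvalues; once these are phases, the whole time
    dependence of an overlap sits in scalar factors. *)
Definition overlap_coef j k := (a *m P') 0 j * (P *m Q') j k * (Q *m b) k 0.

Lemma overlap_diag (x y : 'rV[T]_n) :
  (a *m (P' *m diag_mx x *m P *m (Q' *m diag_mx y *m Q) *m b)) 0 0
  = \sum_j \sum_k x 0 j * y 0 k * overlap_coef j k.
Proof.
rewrite /overlap_coef; set u := a *m P'; set M := P *m Q'; set v := Q *m b.
have -> : a *m (P' *m diag_mx x *m P *m (Q' *m diag_mx y *m Q) *m b)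
    = u *m diag_mx x *m (M *m (diag_mx y *m v)).
  by rewrite /u /M /v !mulmxA.
rewrite mxE; apply: eq_bigr => j _.
rewrite mul_mx_diag [(_ *m (_ *m v)) j 0]mxE mxE mulr_sumr.
apply: eq_bigr => k _; rewrite mul_diag_mx mxE; ring.
Qed.

(** For [x] and [y] the phases of two flows with frequencies [p] and [- q], the right side is the
    termwise derivative of [overlap_diag]; on the left the difference of the generators stands
    between the flows. *)
Lemma overlap_diag_deriv (i : T) (x y p q : 'rV[T]_n) :
  (a *m (P' *m diag_mx x *m P *m (i *: ((P' *m diag_mx p *m P
     - Q' *m diag_mx q *m Q) *m (Q' *m diag_mx y *m Q *m b))))) 0 0
  = \sum_j \sum_k i * (p 0 j - q 0 k) * (x 0 j * y 0 k) * overlap_coef j k.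
Proof.
have conjM A B D E : B *m A = 1%:M :> 'M[T]_n ->
    A *m diag_mx D *m B *m (A *m diag_mx E *m B)
    = A *m diag_mx (\row_l (D 0 l * E 0 l)) *m B.
  by move=> BA; rewrite -mulmx_diag !mulmxA -[in LHS](mulmxA _ B) BA mulmx1.
rewrite -scalemxAr -scalemxAr mxE.
have -> : P' *m diag_mx x *m P *m ((P' *m diag_mx p *m P
     - Q' *m diag_mx q *m Q) *m (Q' *m diag_mx y *m Q *m b))
  = P' *m diag_mx (\row_l (x 0 l * p 0 l)) *m P *m (Q' *m diag_mx y *m Q) *m b
  - P' *m diag_mx x *m P *m (Q' *m diag_mx (\row_l (q 0 l * y 0 l)) *m Q) *m b.
  by rewrite mulmxBl mulmxBr -conjM // -conjM // !mulmxA.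
rewrite mulmxBr mxE [in X in _ + X]mxE !overlap_diag -sumrB mulr_sumr.
apply: eq_bigr => j _; rewrite -sumrB mulr_sumr; apply: eq_bigr => k _.
by rewrite !mxE; ring.
Qed.

End TwoDiagonals.

(** * The real inner product of complex vectors *)

Section InnerProduct.
Variable R : realType.
Local Notation C := R[i].

(** Euclidean inner product of the underlying real space of dimension [2 n]; the angles of the speed
    limit are measured with it. *)
Definition rdot n (u v : 'cV[C]_n) : R := complex.Re ((u ^t* *m v) 0 0).

Lemma adjmx_mul m n p (A : 'M[C]_(m, n)) (B : 'M[C]_(n, p)) :
  (A *m B) ^t* = B ^t* *m A ^t*.
Proof. by rewrite trmx_mul map_mxM. Qed.

Lemma rdotE n (u v : 'cV[C]_n) :
  rdot u v = \sum_i (complex.Re (u i 0) * complex.Re (v i 0)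
                     + complex.Im (u i 0) * complex.Im (v i 0)).
Proof.
rewrite /rdot mxE Re_sum; apply: eq_bigr => i _; rewrite !mxE.
by case: (u i 0) => a b; case: (v i 0) => c d /=; rewrite mulNr opprK.
Qed.

Lemma rdotC n (u v : 'cV[C]_n) : rdot u v = rdot v u.
Proof. by rewrite !rdotE; apply: eq_bigr => i _; congr (_ + _); rewrite mulrC.
    Qed.

Lemma rdotDr n (u v w : 'cV[C]_n) : rdot u (v + w) = rdot u v + rdot u w.
Proof. by rewrite /rdot mulmxDr mxE ReD. Qed.

Lemma rdotZr n (x : R) (u v : 'cV[C]_n) : rdot u (x%:C *: v) = x * rdot u v.
Proof.
by rewrite /rdot -scalemxAr mxE; case: (_ 0 0) => a b; simpc.
Qed.

Lemma rdotDl n (u v w : 'cV[C]_n) : rdot (v + w) u = rdot v u + rdot w u.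
Proof. by rewrite rdotC rdotDr !(rdotC u). Qed.

Lemma rdotZl n (x : R) (u v : 'cV[C]_n) : rdot (x%:C *: u) v = x * rdot u v.
Proof. by rewrite rdotC rdotZr rdotC. Qed.

Lemma rdot_ge0 n (u : 'cV[C]_n) : 0 <= rdot u u.
Proof.
by rewrite rdotE; apply: sumr_ge0 => i _; rewrite -!expr2 addr_ge0 ?sqr_ge0.
Qed.

Lemma rdot_mull n (A : 'M[C]_n) (u v : 'cV[C]_n) :
  rdot (A *m u) v = rdot u (A ^t* *m v).
Proof. by rewrite /rdot adjmx_mul mulmxA. Qed.

Lemma rdot_unitary n (U : 'M[C]_n) (u v : 'cV[C]_n) : U \is unitarymx ->
  rdot (U *m u) (U *m v) = rdot u v.
Proof. by move=> Uu; rewrite rdot_mull mulmxA unitarymxV // mul1mx. Qed.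

(** Bessel's inequality for [a] and the orthonormal pair [z], [z' / J]. *)
Lemma bessel2 n (a z z' : 'cV[C]_n) (J : R) : 0 < J ->
  rdot a a = 1 -> rdot z z = 1 -> rdot z z' = 0 -> rdot z' z' = J ^+ 2 ->
  rdot a z' ^+ 2 <= J ^+ 2 * (1 - rdot a z ^+ 2).
Proof.
move=> J0 aa zz zz' z'z'; set x := rdot a z; set y := rdot a z'.
(* This vector is [a] minus its orthogonal projection on the real span of [z] and [z']. *)
have := rdot_ge0 (a + ((- x)%:C *: z + (- (y / J ^+ 2))%:C *: z')).
rewrite !(rdotDr, rdotDl, rdotZr, rdotZl) -/x -/y (rdotC z a) (rdotC z' a).
rewrite (rdotC z' z) -/x -/y aa zz zz' z'z'.
have J2 : 0 < J ^+ 2 by rewrite exprn_gt0.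
set w := y / J ^+ 2; have -> : y = w * J ^+ 2 by rewrite /w divfK ?gt_eqF.
move: (J ^+ 2) J2 w => j j0 w H.
have -> : (w * j) ^+ 2 = j * (w ^+ 2 * j) by ring.
by rewrite ler_pM2l //; lra.
Qed.

Lemma rdot_iscale n (u v : 'cV[C]_n) : rdot ('i%C *: u) ('i%C *: v) = rdot u v.
Proof.
rewrite !rdotE; apply: eq_bigr => i _; rewrite !mxE.
by case: (u i 0) => a b; case: (v i 0) => c d /=; ring.
Qed.

(** A Hermitian form is real-valued, and the factor [i] makes its value purely imaginary: the
    velocity of a unit vector is orthogonal to it. *)
Lemma rdot_iherm n (W : 'M[C]_n) (v : 'cV[C]_n) : W ^t* = W ->
  rdot v ('i%C *: (W *m v)) = 0.
Proof.
move=> Wh; rewrite /rdot -scalemxAr mxE mulmxA.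
set q := (_ *m v) 0 0; have : q^* = q.
  rewrite /q; set M := _ *m v; rewrite -[in RHS](_ : M ^t* = M) ?mxE //.
  by rewrite /M !adjmx_mul Wh trmxCK mulmxA.
by case: q => x y [yy] /=; lra.
Qed.

End InnerProduct.

(** * Derivatives of overlaps and the bound on the angle *)

Section SpeedLimit.
Variable R : realType.
Local Notation C := R[i].

Lemma is_derive_Re_cis (c : C) (nu t : R) :
  is_derive t 1 (fun s => complex.Re (cis (nu * s) * c))
    (complex.Re ('i%C * nu%:C * cis (nu * t) * c)).
Proof.
case: c => a b; rewrite /cis.
have -> : (fun s => complex.Re ((cos (nu * s) +i* sin (nu * s)) * (a +i* b)))
   = (fun s => a * cos (nu * s) - b * sin (nu * s)).
  by apply/funext => s /=; rewrite mulrC [sin _ * _]mulrC.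
apply: is_derive_eq.
simpc; rewrite /= /GRing.scale /=; ring.
Qed.

Lemma is_derive_sum_ord n (h : 'I_n -> R -> R) (t : R) (dh : 'I_n -> R) :
  (forall i, is_derive t 1 (h i) (dh i)) ->
  is_derive t 1 (fun s => \sum_i h i s) (\sum_i dh i).
Proof.
move=> hd; have -> : (fun s => \sum_i h i s) = \sum_i h i.
  by apply/funext => s; rewrite fct_sumE.
exact: is_derive_sum.
Qed.

Definition cmx n (d : 'rV[R]_n) : 'rV[C]_n := map_mx (real_complex R) d.

Definition flow n (P : 'M[C]_n) (p : 'rV[R]_n) (t : R) : 'M[C]_n :=
  P ^t* *m diag_mx (phases (t *: p)) *m P.

Lemma adj_diag n (x : 'rV[C]_n) : (diag_mx x) ^t* = diag_mx (map_mx Num.conj x).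
Proof. by rewrite tr_diag_mx map_diag_mx. Qed.

Lemma flow_adj n (P : 'M[C]_n) (p : 'rV[R]_n) (t : R) :
  (flow P p t) ^t* = flow P p (- t).
Proof.
rewrite /flow adjmx_mul (adjmx_mul _ (diag_mx _)) trmxCK adj_diag mulmxA.
congr (_ *m diag_mx _ *m _).
by apply/rowP => j; rewrite !mxE conj_cis mulNr.
Qed.

Lemma phases0 n : phases (0 : 'rV[R]_n) = const_mx 1.
Proof. by apply/rowP => j; rewrite !mxE cis0. Qed.

Lemma flow_unitary n (P : 'M[C]_n) (p : 'rV[R]_n) (t : R) :
  P \is unitarymx -> flow P p t \is unitarymx.
Proof.
move=> Pu; have Pu' : P ^t* \is unitarymx by rewrite trmxC_unitary.
apply: mul_unitarymx Pu; apply: mul_unitarymx Pu' _.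
apply/unitarymxP; rewrite adj_diag mulmx_diag; apply/matrixP => i j.
by rewrite !mxE conj_cis -cisD subrr cis0.
Qed.

Lemma flow0 n (P : 'M[C]_n) (p : 'rV[R]_n) : P \is unitarymx ->
  flow P p 0 = 1%:M.
Proof.
by move=> Pu; rewrite /flow scale0r phases0 diag_const_mx mulmx1 unitarymxV.
Qed.

(** The overlap is a finite sum of oscillations with frequencies [p 0 j - q 0 k]; the factors
    produced by differentiation reassemble into [H - L]. *)
Lemma is_derive_flow_overlap n (P Q : 'M[C]_n) (p q : 'rV[R]_n) (a b : 'cV[C]_n)
    (t : R) (H := P ^t* *m diag_mx (cmx p) *m P)
    (L := Q ^t* *m diag_mx (cmx q) *m Q) :
  P \is unitarymx -> Q \is unitarymx ->
  is_derive t 1 (fun s => rdot a (flow P p s *m flow Q q (- s) *m b))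
    (rdot a (flow P p t *m ('i%C *: ((H - L) *m (flow Q q (- t) *m b))))).
Proof.
move=> Pu Qu.
pose c := overlap_coef P (P ^t*) Q (Q ^t*) (a ^t*) b.
have -> : (fun s => rdot a (flow P p s *m flow Q q (- s) *m b))
    = (fun s => \sum_j \sum_k complex.Re (cis ((p 0 j - q 0 k) * s) * c j k)).
  apply/funext => s; rewrite /rdot overlap_diag Re_sum; apply: eq_bigr => j _.
  rewrite Re_sum; apply: eq_bigr => k _; rewrite -/c; move: (c j k) => cjk.
  by rewrite !mxE -cisD; congr (complex.Re (cis _ * _)); ring.
have -> : rdot a (flow P p t *m ('i%C *: ((H - L) *m (flow Q q (- t) *m b))))
    = \sum_j \sum_k complex.Re
        ('i%C * (p 0 j - q 0 k)%:C * cis ((p 0 j - q 0 k) * t) * c j k).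
  rewrite /rdot overlap_diag_deriv; [|exact/unitarymxP..].
  rewrite Re_sum; apply: eq_bigr => j _.
  rewrite Re_sum; apply: eq_bigr => k _; rewrite -/c; move: (c j k) => cjk.
  rewrite !mxE -cisD rmorphB; congr (complex.Re (_ * cis _ * _)); ring.
apply: is_derive_sum_ord => j; apply: is_derive_sum_ord => k.
exact: is_derive_Re_cis.
Qed.

(* The factor [lam] keeps the argument of [acos] away from the end points, where
   [acos] is not differentiable. *)
Lemma acos_speed (F F' : R -> R) (J s lam : R) : 0 <= J -> 0 <= s ->
  0 < lam < 1 ->
  (forall t : R, is_derive t (1 : R) F (F' t)) ->
  (forall t, F' t ^+ 2 <= J ^+ 2 * (1 - F t ^+ 2)) ->
  (forall t, F t ^+ 2 <= 1) ->
  acos (lam * F s) <= acos (lam * F 0) + J * s.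
Proof.
move=> J0 s0 /andP[l0 l1] Fd F'le Fle.
have lF2 t : (lam * F t) ^+ 2 < 1.
  have := Fle t; rewrite exprMn; have : lam ^+ 2 < 1 by rewrite expr_lt1 // ltW.
  have := sqr_ge0 (F t); have := sqr_ge0 lam; nra.
have lF t : -1 < lam * F t < 1 by have := lF2 t; nra.
pose g t := acos (lam * F t).
pose g' t := - (Num.sqrt (1 - (lam * F t) ^+ 2))^-1 * (lam * F' t).
have gd (t : R) : is_derive t (1 : R) g (g' t).
  have kd : is_derive t (1 : R) (fun u => lam * F u) (lam * F' t).
    exact: is_deriveZ.
  exact: (@is_derive1_comp R (@acos R) (fun u => lam * F u) t _ _
            (is_derive1_acos (lF t)) kd).
(* From the bound on [F'], [lam^2 F'^2 <= J^2 (lam^2 - lam^2 F^2) <= J^2 (1 - lam^2 F^2)], and the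
   last factor is the square of the denominator of [g']. *)
have g'le t : `|g' t| <= J.
  set y := 1 - (lam * F t) ^+ 2; have y0 : 0 < y by rewrite subr_gt0.
  have sy0 : 0 < Num.sqrt y by rewrite sqrtr_gt0.
  rewrite /g' -/y mulNr normrN mulrC normrM [`|_^-1|]gtr0_norm ?invr_gt0 //.
  rewrite ler_pdivrMr // -(@ler_pXn2r _ 2) ?nnegrE ?normr_ge0 //; last first.
    by rewrite mulr_ge0 // ltW.
  rewrite real_normK ?num_real // 2!exprMn sqr_sqrtr ?(ltW y0) //.
  have := F'le t; rewrite /y exprMn.
  have : lam ^+ 2 < 1 by rewrite expr_lt1 // ltW.
  have := sqr_ge0 (F t); have := sqr_ge0 lam; have := sqr_ge0 J.
  have := sqr_ge0 (F' t); have := Fle t.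
  move: (lam ^+ 2) (F t ^+ 2) (F' t ^+ 2) (J ^+ 2) => l f f' j; nra.
have [] := @MVT_segment R g g' 0 s s0 (fun x _ => gd x).
  apply: derivable_within_continuous => x _; by case: (gd x).
move=> x _; rewrite -/(g s) -/(g 0) subr0 => gE.
rewrite -lerBlDl gE; apply: ler_wpM2r => //.
exact: le_trans (ler_norm _) (g'le x).
Qed.

(* Since [W] is [J] times an involution, the motion of one flow relative to the
   other moves unit vectors at speed exactly [J], orthogonally to themselves. *)
Lemma flow_speed n (P Q : 'M[C]_n) (p q : 'rV[R]_n) (J s lam : R)
    (a b : 'cV[C]_n) (W := P ^t* *m diag_mx (cmx p) *m P
                         - Q ^t* *m diag_mx (cmx q) *m Q) :
  P \is unitarymx -> Q \is unitarymx -> 0 < J -> W ^t* = W ->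
  W *m W = ((J ^+ 2)%:C)%:M -> 0 <= s -> 0 < lam < 1 ->
  rdot a a = 1 -> rdot b b = 1 ->
  acos (lam * rdot a (flow P p s *m flow Q q (- s) *m b))
    <= acos (lam * rdot a b) + J * s.
Proof.
move=> Pu Qu J0 Wh W2 s0 lam01 aa bb.
pose F t := rdot a (flow P p t *m flow Q q (- t) *m b).
pose F' t := rdot a (flow P p t *m ('i%C *: (W *m (flow Q q (- t) *m b)))).
(* [F t] and [F' t] are the inner products of [a] with a unit vector and with an orthogonal vector
   of length [J], both carried along by the unitary [flow P p t]. *)
have bess t : F' t ^+ 2 <= J ^+ 2 * (1 - F t ^+ 2) .
  rewrite /F /F' -mulmxA; set v := flow Q q (- t) *m b.
  have vv : rdot v v = 1 by rewrite /v rdot_unitary ?flow_unitary.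
  have WvWv : rdot (W *m v) (W *m v) = J ^+ 2.
    by rewrite rdot_mull Wh mulmxA W2 mul_scalar_mx rdotZr vv mulr1.
  have fu := flow_unitary p t Pu.
  apply: (bessel2 J0 aa); rewrite (rdot_unitary _ _ fu).
  - exact: vv.
  - exact: rdot_iherm.
  by rewrite rdot_iscale.
have FE : F 0 = rdot a b by rewrite /F oppr0 !flow0 // !mul1mx.
rewrite -FE; apply: (@acos_speed F F') => //; first exact: ltW.
  by move=> t; apply: is_derive_flow_overlap.
move=> t; have := bess t; have := sqr_ge0 (F' t).
have : 0 < J ^+ 2 by rewrite exprn_gt0.
by move: (_ ^+ 2) (_ ^+ 2) (F t ^+ 2) => *; nra.
Qed.

End SpeedLimit.

(** * Tensor products and Pauli matrices *)

Section Tensor.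
Variable T : comPzRingType.

Lemma tensmxDr m n p q (A : 'M[T]_(m, n)) (D E : 'M[T]_(p, q)) :
  A *t (D + E) = A *t D + A *t E.
Proof. by apply/matrixP => i j; rewrite !mxE mulrDr. Qed.

Lemma tensmxZl m n p q c (A : 'M[T]_(m, n)) (D : 'M[T]_(p, q)) :
  (c *: A) *t D = c *: (A *t D).
Proof. by apply/matrixP => i j; rewrite !mxE mulrA. Qed.

Lemma tensmxZr m n p q c (A : 'M[T]_(m, n)) (D : 'M[T]_(p, q)) :
  A *t (c *: D) = c *: (A *t D).
Proof. by apply/matrixP => i j; rewrite !mxE mulrCA. Qed.

Lemma tens_diag m n (x : 'rV[T]_m) (y : 'rV[T]_n) :
  diag_mx x *t diag_mx y
  = diag_mx (\row_k (x 0 (mxtens_unindex k).1 * y 0 (mxtens_unindex k).2)).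
Proof.
apply/matrixP => i j; case: (mxtens_indexP i) => i0 i1.
case: (mxtens_indexP j) => j0 j1; rewrite tensmxE !mxE mxtens_indexK /=.
rewrite (can_eq (@mxtens_indexK _ _)) xpair_eqE.
by case: (i0 =P j0); case: (i1 =P j1); rewrite /= ?mulr1n ?mulr0n ?mulr0 ?mul0r.
Qed.

Lemma tensmx11 m n : (1%:M : 'M[T]_m) *t (1%:M : 'M[T]_n) = 1%:M.
Proof.
rewrite -!diag_const_mx tens_diag; congr diag_mx.
by apply/rowP => k; rewrite !mxE mulr1.
Qed.

End Tensor.

Section Pauli.
Variable R : realType.
Local Notation C := R[i].

Lemma adj_tens m n p q (A : 'M[C]_(m, n)) (B : 'M[C]_(p, q)) :
  (A *t B) ^t* = A ^t* *t B ^t*.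
Proof. by rewrite trmx_tens map_mxT. Qed.

Lemma tens_unitary m n (A : 'M[C]_m) (B : 'M[C]_n) :
  A \is unitarymx -> B \is unitarymx -> A *t B \is unitarymx.
Proof.
move=> /unitarymxP Au /unitarymxP Bu; apply/unitarymxP.
by rewrite adj_tens tensmx_mul Au Bu tensmx11.
Qed.

Lemma matrix2P (T : Type) (A B : 'M[T]_2) :
  A 0 0 = B 0 0 -> A 0 1 = B 0 1 -> A 1 0 = B 1 0 -> A 1 1 = B 1 1 -> A = B.
Proof.
move=> e00 e01 e10 e11; apply/matrixP => i j.
have oE (k : 'I_2) : k = 0 \/ k = 1.
  by case: k => [[|[|//]] ?]; [left|right]; apply: val_inj.
by case: (oE i) => ->; case: (oE j) => ->.
Qed.

Lemma mulmx2E (T : pzRingType) (A B : 'M[T]_2) i j :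
  (A *m B) i j = A i 0 * B 0 j + A i 1 * B 1 j.
Proof.
rewrite mxE !big_ord_recl big_ord0 addr0; congr (_ + A i _ * B _ j).
all: exact: val_inj.
Qed.

Lemma ord3P (P : 'I_3 -> Prop) :
  P ord0 -> P (lift ord0 ord0) -> P ord_max -> forall k, P k.
Proof.
move=> P0 P1 P2 [[|[|[|//]]] k3].
- by rewrite (_ : Ordinal k3 = ord0) //; apply: val_inj.
- by rewrite (_ : Ordinal k3 = lift ord0 ord0) //; apply: val_inj.
- by rewrite (_ : Ordinal k3 = ord_max) //; apply: val_inj.
Qed.

Lemma pauli_herm k : (pauli R k) ^t* = pauli R k.
Proof.
elim/ord3P: k; apply: matrix2P; rewrite !mxE /= ?rmorph0 ?rmorph1 ?rmorphN1 //.
all: by apply/eqP; rewrite eq_complex /= ?oppr0 ?opprK ?eqxx.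
Qed.

Lemma pauli_sqr k : pauli R k *m pauli R k = 1%:M.
Proof.
elim/ord3P: k; apply: matrix2P; rewrite !mulmx2E !mxE /=.
all: apply/eqP; rewrite eq_complex /=; apply/andP; split; apply/eqP; ring.
Qed.

Lemma pauli_tr k : \tr (pauli R k) = 0.
Proof.
elim/ord3P: k; rewrite /mxtrace !big_ord_recl big_ord0 !mxE /=.
all: by rewrite ?addr0 // subrr.
Qed.

End Pauli.

(** * The speed limit for realizable gates *)

Section RealizableSpeed.
Variable R : realType.
Local Notation C := R[i].

Lemma adjmxD m n (A B : 'M[C]_(m, n)) : (A + B) ^t* = A ^t* + B ^t*.
Proof. by rewrite linearD /= map_mxD. Qed.

Lemma adjmxB m n (A B : 'M[C]_(m, n)) : (A - B) ^t* = A ^t* - B ^t*.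
Proof. by rewrite linearB /= map_mxB. Qed.

Lemma adjmxZ m n (c : C) (A : 'M[C]_(m, n)) : (c *: A) ^t* = (Num.conj c) *: A
    ^t*.
Proof. by rewrite linearZ /= map_mxZ. Qed.

Lemma adjmx_sum n (I : finType) (F : I -> 'M[C]_n) :
  (\sum_i F i) ^t* = \sum_i (F i) ^t*.
Proof.
apply: (big_morph (fun A => A ^t*)) => [A B|]; first exact: adjmxD.
by rewrite trmx0 map_mx0.
Qed.

Lemma adjmx1 n : (1%:M : 'M[C]_n) ^t* = 1%:M.
Proof. by rewrite trmx1 map_mx1. Qed.

Lemma conj_realC (x : R) : Num.conj x%:C = x%:C.
Proof. exact: conjc_real. Qed.

Lemma unitarymxM n (A B : 'M[C]_n) :
  A \is unitarymx -> B \is unitarymx -> A *m B \is unitarymx.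
Proof. exact: mul_unitarymx. Qed.

Lemma field_herm (u : 'I_3 -> R) :
  (\sum_i (u i)%:C *: pauli R i) ^t* = \sum_i (u i)%:C *: pauli R i.
Proof.
by rewrite adjmx_sum; apply: eq_bigr => i _; rewrite adjmxZ conj_realC
    pauli_herm.
Qed.

Lemma hamiltonian_herm J m l (uS uB : 'I_3 -> R) :
  (hamiltonian J m l uS uB) ^t* = hamiltonian J m l uS uB.
Proof.
rewrite /hamiltonian !adjmxD !adj_tens !field_herm adjmx1 adjmxZ adj_tens.
by rewrite !pauli_herm conj_realC.
Qed.

Lemma flow_tens m n (P : 'M[C]_m) (Q : 'M[C]_n) (p : 'rV[R]_m) (q : 'rV[R]_n) t
    :
  flow P p t *t flow Q q t
  = flow (P *t Q) (\row_k (p 0 (mxtens_unindex k).1 + q 0 (mxtens_unindex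
      k).2)) t.
Proof.
rewrite /flow adj_tens -tensmx_mul -tensmx_mul tens_diag.
set d := \row_k _; set e := phases _; have -> // : d = e.
by apply/rowP => k; rewrite !mxE mulrDr cisD.
Qed.

(** Generators acting on different factors are diagonalized together and their eigenvalues add; this
    is the generator that goes with the flow in [flow_tens]. *)
Lemma diag_tens_sum m n (P : 'M[C]_m) (Q : 'M[C]_n) (p : 'rV[R]_m) (q :
    'rV[R]_n) :
  P \is unitarymx -> Q \is unitarymx ->
  (P ^t* *m diag_mx (cmx p) *m P) *t 1%:M + 1%:M *t (Q ^t* *m diag_mx (cmx q)
      *m Q)
  = (P *t Q) ^t* *m diag_mx (cmx (\row_k (p 0 (mxtens_unindex k).1
       + q 0 (mxtens_unindex k).2))) *m (P *t Q).
Proof.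
move=> Pu Qu.
have -> : diag_mx (cmx (\row_k (p 0 (mxtens_unindex k).1 + q 0 (mxtens_unindex
    k).2)))
   = diag_mx (cmx p) *t 1%:M + 1%:M *t diag_mx (cmx q).
  rewrite -!diag_const_mx !tens_diag -linearD /=; congr diag_mx.
  by apply/rowP => k; rewrite !mxE mulr1 mul1r rmorphD.
rewrite mulmxDr mulmxDl adj_tens !tensmx_mul !mulmx1 !unitarymxV //.
Qed.

Lemma realizable_unitary (J : R) m l T U : realizable J m l T U ->
  0 <= T /\ U \is unitarymx.
Proof.
elim=> [|t V K _ [t0 Vu] [kS [kB [[ku _] [ku' _] ->]]]|t V s uS uB _ [t0 Vu]
    s0].
- by split=> //; apply/unitarymxP; rewrite adjmx1 mulmx1.
- split; first exact: t0.
  exact: unitarymxM (tens_unitary ku ku') Vu.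
split; first exact: addr_ge0.
have Hh := hamiltonian_herm J m l uS uB.
have [P [p [Pu ->]]] := hermitian_diagonal Hh.
rewrite hermitian_flow; last exact: Pu.
exact: unitarymxM (flow_unitary p (- s) Pu) Vu.
Qed.

(* The free evolution [kS *t kB] under the local fields alone is the comparison
   motion: relative to it, states move at speed [J]. *)
Lemma realizable_overlap (J : R) m l T U : 0 < J -> realizable J m l T U ->
  exists kS kB : 'M[C]_2, [/\ kS \is unitarymx, kB \is unitarymx &
    forall (w : 'cV[C]_(2 * 2)) lam, rdot w w = 1 -> 0 < lam < 1 ->
      acos (lam * rdot (U *m w) ((kS *t kB) *m w)) <= acos lam + J * T].
Proof.
move=> J0 UT; elim: UT => {T U} [|t U K _ [kS [kB [kSu kBu IH]]]|
    t U s uS uB UT [kS [kB [kSu kBu IH]]] s0].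
- exists 1%:M, 1%:M; have u1 : (1%:M : 'M[C]_2) \is unitarymx.
    by apply/unitarymxP; rewrite adjmx1 mulmx1.
  by split=> // w lam ww _; rewrite tensmx11 mul1mx ww mulr1 mulr0 addr0.
- case=> lS [lB [[lSu _] [lBu _] ->]].
  exists (lS *m kS), (lB *m kB); split; [exact: unitarymxM lSu kSu|exact:
      unitarymxM lBu kBu|].
  move=> w lam ww laml; rewrite -tensmx_mul -!mulmxA.
  by rewrite rdot_unitary ?tens_unitary //; apply: IH.
have [_ Uu] := realizable_unitary UT.
have Hh := hamiltonian_herm J m l uS uB.
have [P [p [Pu HE]]] := hermitian_diagonal Hh.
have [PS [pS [PSu SE]]] := hermitian_diagonal (field_herm uS).
have [PB [pB [PBu BE]]] := hermitian_diagonal (field_herm uB).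
exists (flow PS pS (- s) *m kS), (flow PB pB (- s) *m kB).
split; [exact: unitarymxM (flow_unitary pS (- s) PSu) kSu|
        exact: unitarymxM (flow_unitary pB (- s) PBu) kBu|].
(* The full flow is moved to the other side of the inner product, where it meets the inverse-time
   local flow: the relative motion treated by [flow_speed]. *)
move=> w lam ww laml; rewrite HE hermitian_flow // -[_ *m P]/(flow P p (- s)).
rewrite -tensmx_mul flow_tens -(mulmxA (flow P p _)).
rewrite -(mulmxA (flow (PS *t PB) _ _)) rdot_mull flow_adj opprK.
rewrite (mulmxA (flow P p s)).
have laU : rdot (U *m w) (U *m w) = 1 by rewrite rdot_unitary.
have lak : rdot ((kS *t kB) *m w) ((kS *t kB) *m w) = 1.
  by rewrite rdot_unitary ?tens_unitary.
(* Angles add up: the induction hypothesis covers the time before this evolution, [flow_speed] the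
   growth by [J * s] during it. *)
have := IH w lam ww laml; rewrite mulrDr addrA.
rewrite -(lerD2r (J * s)) => /(le_trans _); apply.
apply: (flow_speed Pu (tens_unitary PSu PBu) J0 _ _ s0 laml laU lak).
  rewrite -diag_tens_sum // -HE -SE -BE adjmxB Hh; congr (_ - _).
  by rewrite adjmxD !adj_tens !field_herm adjmx1.
(* Subtracting the local fields leaves the coupling term alone, [J] times a tensor product of Pauli
   matrices, whose square is [J ^+ 2]. *)
rewrite -diag_tens_sum // -HE -SE -BE /hamiltonian addrC addKr.
rewrite -scalemxAr -scalemxAl tensmx_mul !pauli_sqr tensmx11 scalerA -rmorphM.
by rewrite scale_scalar_mx mulr1.
Qed.

(** At zero overlap the angle is [pi / 2] whatever [lam] is, so letting [lam] tend to 1 removes the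
    term [acos lam]. *)
Lemma orthogonal_reach_time (J : R) m l T U : 0 < J -> realizable J m l T U ->
  exists kS kB : 'M[C]_2, [/\ kS \is unitarymx, kB \is unitarymx &
    forall w : 'cV[C]_(2 * 2), rdot w w = 1 ->
      rdot (U *m w) ((kS *t kB) *m w) = 0 -> pi / (2 * J) <= T].
Proof.
move=> J0 UT; have [kS [kB [kSu kBu H]]] := realizable_overlap J0 UT.
exists kS, kB; split=> // w ww w0.
rewrite invfM mulrA ler_pdivrMr // [T * J]mulrC.
(* The factor is [lam = cos e], for which [acos lam = e]; for [e] beyond [pi / 2] the bound is
   immediate. *)
apply/ler_addgt0Pl => e e0.
have [e1|e1] := leP (pi / 2) e.
  have [T0 _] := realizable_unitary UT.
  by rewrite (le_trans e1) // lerDl mulr_ge0 // ltW.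
have pi0 := pi_gt0 R.
have eE : acos (cos e) = e by rewrite cosK // in_itv /=; apply/andP; split; lra.
have /(H w (cos e) ww) : 0 < cos e < 1.
  rewrite cos_gt0_pihalf /=; last by apply/andP; split; lra.
  by rewrite -[X in _ < X]cos0 ltr_cos ?in_itv /= ?lexx ?pi_ge0 //; apply/andP;
      split; lra.
by rewrite w0 mulr0 acos0 eE.
Qed.

End RealizableSpeed.

(** * Partial trace *)

Section PartialTrace.
Variable R : realType.
Local Notation C := R[i].

Lemma big_mxtens (V : Type) (idx : V) (op : Monoid.com_law idx) m n
    (F : 'I_(m * n) -> V) :
  \big[op/idx]_k F k = \big[op/idx]_i \big[op/idx]_j F (mxtens_index (i, j)).
Proof.
rewrite pair_bigA /= (reindex (@mxtens_index m n)) /=.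
  by apply: eq_bigr => -[].
by exists (@mxtens_unindex m n) => k _; rewrite ?mxtens_indexK ?mxtens_unindexK.
Qed.

Lemma ptraceBE (M : 'M[C]_(2 * 2)) a b :
  ptraceB M a b = \sum_k M (mxtens_index (a, k)) (mxtens_index (b, k)).
Proof. by rewrite mxE. Qed.

Lemma ptraceBD (A B : 'M[C]_(2 * 2)) : ptraceB (A + B) = ptraceB A + ptraceB B.
Proof.
apply/matrixP => a b; rewrite !mxE -big_split.
by apply: eq_bigr => k _; rewrite !mxE.
Qed.

Lemma ptraceBZ c (A : 'M[C]_(2 * 2)) : ptraceB (c *: A) = c *: ptraceB A.
Proof.
apply/matrixP => a b; rewrite !mxE mulr_sumr.
by apply: eq_bigr => k _; rewrite !mxE.
Qed.

Lemma ptraceB_tens (A B : 'M[C]_2) : ptraceB (A *t B) = \tr B *: A.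
Proof.
apply/matrixP => a b; rewrite !mxE mulr_suml; apply: eq_bigr => k _.
by rewrite tensmxE mulrC.
Qed.

Lemma ptraceB_adj (A : 'M[C]_(2 * 2)) : ptraceB (A ^t*) = (ptraceB A) ^t*.
Proof.
apply/matrixP => a b; rewrite !mxE rmorph_sum; apply: eq_bigr => k _.
by rewrite !mxE.
Qed.

Lemma ptraceB_mull (A : 'M[C]_2) (M : 'M[C]_(2 * 2)) :
  ptraceB ((A *t 1%:M) *m M) = A *m ptraceB M.
Proof.
apply/matrixP => a b; rewrite ptraceBE mxE.
under [RHS]eq_bigr => c _ do rewrite ptraceBE mulr_sumr.
rewrite exchange_big; apply: eq_bigr => k _.
rewrite mxE big_mxtens; apply: eq_bigr => c _.
rewrite (bigD1 k) //= big1 ?addr0 => [|j jk]; rewrite tensmxE mxE.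
  by rewrite eqxx mulr1.
by rewrite eq_sym (negbTE jk) mulr0 mul0r.
Qed.

Lemma ptraceB_mulr (A : 'M[C]_2) (M : 'M[C]_(2 * 2)) :
  ptraceB (M *m (A *t 1%:M)) = ptraceB M *m A.
Proof.
apply/matrixP => a b; rewrite ptraceBE mxE.
under [RHS]eq_bigr => c _ do rewrite ptraceBE mulr_suml.
rewrite exchange_big; apply: eq_bigr => k _.
rewrite mxE big_mxtens; apply: eq_bigr => c _.
rewrite (bigD1 k) //= big1 ?addr0 => [|j jk]; rewrite tensmxE mxE.
  by rewrite eqxx mulr1.
by rewrite (negbTE jk) !mulr0.
Qed.

Lemma ptraceB_cyclic (B : 'M[C]_2) (M : 'M[C]_(2 * 2)) :
  ptraceB ((1%:M *t B) *m M) = ptraceB (M *m (1%:M *t B)).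
Proof.
apply/matrixP => a b; rewrite !ptraceBE.
have lE k : ((1%:M *t B) *m M) (mxtens_index (a, k)) (mxtens_index (b, k))
    = \sum_j B k j * M (mxtens_index (a, j)) (mxtens_index (b, k)).
  rewrite mxE big_mxtens (bigD1 a) //= [X in _ + X]big1 ?addr0 => [|c ca].
    by apply: eq_bigr => j _; rewrite tensmxE mxE eqxx mul1r.
  by apply: big1 => j _; rewrite tensmxE mxE eq_sym (negbTE ca) !mul0r.
have rE k : (M *m (1%:M *t B)) (mxtens_index (a, k)) (mxtens_index (b, k))
    = \sum_j M (mxtens_index (a, k)) (mxtens_index (b, j)) * B j k.
  rewrite mxE big_mxtens (bigD1 b) //= [X in _ + X]big1 ?addr0 => [|c ca].
    by apply: eq_bigr => j _; rewrite tensmxE mxE eqxx mul1r.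
  by apply: big1 => j _; rewrite tensmxE mxE (negbTE ca) mul0r mulr0.
under eq_bigr do rewrite lE; under [RHS]eq_bigr do rewrite rE.
rewrite exchange_big; apply: eq_bigr => j _; apply: eq_bigr => k _.
by rewrite mulrC.
Qed.

(** The qubit factors leave the partial trace on either side, while the ancilla factors meet by
    cyclicity and cancel. *)
Lemma ptraceB_local (A B : 'M[C]_2) (M : 'M[C]_(2 * 2)) : B \is unitarymx ->
  ptraceB ((A *t B) *m M *m (A *t B) ^t*) = A *m ptraceB M *m A ^t*.
Proof.
move=> Bu; have -> : (A *t B) *m M *m (A *t B) ^t*
    = (A *t 1%:M) *m ((1%:M *t B) *m (M *m (1%:M *t B ^t*))) *m (A ^t* *t 1%:M).
  rewrite adj_tens (tensmx_decr A B) (tensmx_decl (A ^t*)).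
  by move: (A ^t* *t _) (_ *t B ^t*) => X Y; rewrite !mulmxA.
rewrite ptraceB_mulr ptraceB_mull ptraceB_cyclic -(mulmxA M) tensmx_mul mul1mx.
by rewrite unitarymxV // tensmx11 mulmx1.
Qed.

Lemma tr_ptraceB (M : 'M[C]_(2 * 2)) : \tr (ptraceB M) = \tr M.
Proof. by rewrite /mxtrace big_mxtens; apply: eq_bigr => a _; rewrite ptraceBE.
    Qed.

Lemma tr_tens (A B : 'M[C]_2) : \tr (A *t B) = \tr A * \tr B.
Proof. by rewrite -tr_ptraceB ptraceB_tens mxtraceZ mulrC. Qed.

Lemma tr_adj_ge0 m n (A : 'M[C]_(m, n)) : 0 <= complex.Re (\tr (A *m A ^t*)).
Proof.
rewrite /mxtrace Re_sum; apply: sumr_ge0 => i _; rewrite mxE Re_sum.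
apply: sumr_ge0 => j _; rewrite !mxE; case: (A i j) => x y /=.
by rewrite mulrN opprK -!expr2 addr_ge0 ?sqr_ge0.
Qed.

(** The trace is the squared Frobenius norm, a sum of squares of the real and imaginary parts of the
    entries. *)
Lemma tr_adj_eq0 m n (A : 'M[C]_(m, n)) : complex.Re (\tr (A *m A ^t*)) <= 0 ->
    A = 0.
Proof.
have term0 i j : 0 <= complex.Re (A i j * (A ^t*) j i).
  rewrite !mxE; case: (A i j) => x y /=.
  by rewrite mulrN opprK -!expr2 addr_ge0 ?sqr_ge0.
have sumE : complex.Re (\tr (A *m A ^t*))
    = \sum_i \sum_j complex.Re (A i j * (A ^t*) j i).
  by rewrite /mxtrace Re_sum; apply: eq_bigr => i _; rewrite mxE Re_sum.
move=> A0; have /eqP : complex.Re (\tr (A *m A ^t*)) = 0.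
  by apply/eqP; rewrite eq_le A0 tr_adj_ge0.
rewrite sumE psumr_eq0; last by move=> i _; apply: sumr_ge0.
move=> /allP H; apply/matrixP => i j; have := H i (mem_index_enum _).
rewrite psumr_eq0 //= => /allP /(_ j (mem_index_enum _)) /=.
rewrite !mxE; case: (A i j) => x y /=; rewrite mulrN opprK -!expr2.
rewrite paddr_eq0 ?sqr_ge0 // !sqrf_eq0 => /andP[/eqP -> /eqP ->].
by [].
Qed.

End PartialTrace.

(** * Purity of the reset qubit *)

Lemma tr_sqr_shift (T : comNzRingType) (c : T) (m : 'M[T]_2) : \tr m = 0 ->
  \tr ((c *: 1%:M + m) *m (c *: 1%:M + m)) = c * c * 2 + \tr (m *m m).
Proof.
move=> mt; rewrite scalemx1 mulmxDl !mulmxDr mul_scalar_mx mul_mx_scalar.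
rewrite mul_scalar_mx !mxtraceD !mxtraceZ mt !mulr0 mxtrace_scalar.
by move: (\tr _) => t; ring.
Qed.

Lemma tr_sqrB (T : comNzRingType) n (X Y : 'M[T]_n) :
  \tr ((X - Y) *m (X - Y)) = \tr (X *m X) - 2 * \tr (X *m Y) + \tr (Y *m Y).
Proof.
rewrite mulmxBl !mulmxBr !raddfB /= (mxtrace_mulC Y X).
by move: (\tr (X *m X)) (\tr (X *m Y)) (\tr (Y *m Y)) => a b c; ring.
Qed.

Lemma tens1_scalar (T : comNzRingType) m n (c : T) :
  (1%:M : 'M[T]_m) *t (c%:M : 'M[T]_n) = c%:M.
Proof. by rewrite -!(scalemx1 _ c) tensmxZr tensmx11. Qed.

Lemma mul_scalarmx_mid (T : comNzRingType) n (A B : 'M[T]_n) c :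
  A *m (c%:M *m B) = c *: (A *m B).
Proof. by rewrite mul_scalar_mx scalemxAr. Qed.

Section Purity.
Variable R : realType.
Local Notation C := R[i].

(** For [n = 2], a Bloch vector of length [|x|], encoded by the square of the matrix. Either sign of
    [x] is allowed, so the same matrix gives eigenvectors for both eigenvalues. *)
Definition traceless_herm n (r : 'M[C]_n) (x : R) : Prop :=
  [/\ r ^t* = r, \tr r = 0 & r *m r = ((x ^+ 2)%:C)%:M].

Lemma mxtrace2 (A : 'M[C]_2) : \tr A = A 0 0 + A 1 1.
Proof.
rewrite /mxtrace !big_ord_recl big_ord0 addr0; congr (_ + A _ _); exact:
    val_inj.
Qed.

(** By Cayley-Hamilton the square is minus the determinant, here a sum of three real squares. *)
Lemma herm2_traceless (r : 'M[C]_2) : r ^t* = r -> \tr r = 0 ->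
  exists2 x : R, 0 <= x & r *m r = ((x ^+ 2)%:C)%:M.
Proof.
move=> rh; rewrite mxtrace2 => /eqP; rewrite addr_eq0 => /eqP r0.
have E i j : Num.conj (r j i) = r i j by rewrite -[in RHS]rh !mxE.
have := E 1 1; have := E 0 1; move: r0.
case e11: (r 1 1) => [a b]; case e10 : (r 1 0) => [c d] e00 /esym e01 [bb].
have {bb}b0 : b = 0 by lra.
exists (Num.sqrt (a ^+ 2 + (c ^+ 2 + d ^+ 2))); first exact: sqrtr_ge0.
rewrite sqr_sqrtr ?addr_ge0 ?sqr_ge0 //.
apply: matrix2P; rewrite !mulmx2E !mxE ?e00 ?e01 ?e10 ?e11 b0 /=.
all: apply/eqP; rewrite eq_complex /= ?oppr0; apply/andP; split; apply/eqP;
    ring.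
Qed.

Lemma density_traceless_part (rhoB : 'M[C]_2) :
  density_matrix rhoB -> rhoB <> 2^-1 *: 1%:M ->
  exists r x, [/\ 0 < x, traceless_herm r x & rhoB = 2^-1 *: 1%:M + r].
Proof.
move=> [pos tr1] neq.
have form (v : 'cV[C]_2) : (v ^t* *m rhoB *m v) 0 0 =
   Num.conj (v 0 0) * rhoB 0 0 * v 0 0 + Num.conj (v 1 0) * rhoB 1 0 * v 0 0
   + (Num.conj (v 0 0) * rhoB 0 1 * v 1 0 + Num.conj (v 1 0) * rhoB 1 1 * v 1
       0).
  have o1 : lift ord0 ord0 = 1 :> 'I_2 by apply: val_inj.
  rewrite mxE !big_ord_recl big_ord0 addr0 o1 !mxE !big_ord_recl !big_ord0
      !addr0.
  by rewrite o1 !mxE !mulrDl.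
have rh : rhoB ^t* = rhoB.
  (* Reality of the quadratic form at the vectors [(1, 0)], [(0, 1)], [(1, 1)] and [(1, i)]
     determines all the relations between entries that make [rhoB] Hermitian. *)
  pose vec (a b : C) : 'cV[C]_2 := \col_i (if i == 0 then a else b).
  have := pos (vec 1 0); have := pos (vec 0 1).
  have := pos (vec 1 1); have := pos (vec 1 'i%C).
  rewrite !form !mxE /=.
  case e00: (rhoB 0 0) => [a a']; case e01: (rhoB 0 1) => [b b'].
  case e10: (rhoB 1 0) => [c c']; case e11: (rhoB 1 1) => [d d'].
  do 4 (move=> /ger0_Im /=; rewrite ?(mulr0, mul0r, mulr1, mul1r, addr0, oppr0,
    subr0, add0r, mulrN, mulNr, opprK) => ?).
  apply: matrix2P; rewrite !mxE ?e00 ?e01 ?e10 ?e11.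
  - change (a -i* a' = a +i* a'); congr (_ +i* _); lra.
  - change (c -i* c' = b +i* b'); congr (_ +i* _); lra.
  - change (b -i* b' = c +i* c'); congr (_ +i* _); lra.
  - change (d -i* d' = d +i* d'); congr (_ +i* _); lra.
pose r := rhoB - 2^-1 *: 1%:M.
have rE : rhoB = 2^-1 *: 1%:M + r by rewrite /r addrC subrK.
have two : Num.conj (2^-1 : C) = 2^-1 by rewrite fmorphV rmorph_nat.
have r_herm : r ^t* = r by rewrite /r adjmxB adjmxZ adjmx1 two rh.
have r_tr : \tr r = 0.
  by rewrite /r linearB linearZ /= mxtrace1 tr1 mulVf ?subrr // pnatr_eq0.
have [x x0 rr] := herm2_traceless r_herm r_tr.
exists r, x; split=> //; rewrite lt_neqAle x0 andbT eq_sym.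
(* If [x] vanished, the Hermitian [r] would have square zero, hence Frobenius norm zero, and the
   state would be maximally mixed. *)
apply/eqP => xz; apply: neq; rewrite rE (_ : r = 0) ?addr0 //.
apply: tr_adj_eq0; rewrite r_herm rr xz expr0n /= mxtrace_scalar.
by rewrite mul0rn.
Qed.

Lemma traceless_herm_conj n (k r : 'M[C]_n) x : k \is unitarymx ->
  traceless_herm r x -> traceless_herm (k *m r *m k ^t*) x.
Proof.
move=> ku [rh rt rr]; split.
- by rewrite adjmx_mul (adjmx_mul k r) trmxCK rh mulmxA.
- by rewrite mxtrace_mulC mulmxA unitarymxV // mul1mx.
have -> : k *m r *m k ^t* *m (k *m r *m k ^t*) = k *m r *m (k ^t* *m k) *m (r
    *m k ^t*).
  by move: (k ^t*) => k'; rewrite !mulmxA.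
rewrite unitarymxV // mulmx1 -mulmxA (mulmxA r) rr mul_scalar_mx.
by rewrite -scalemxAr (unitarymxP ku) scalemx1.
Qed.

Section FixedState.
Variables (rhoB r : 'M[C]_2) (x : R).
Hypotheses (rx : traceless_herm r x) (rhoE : rhoB = 2^-1 *: 1%:M + r).

Definition transfers (U : 'M[C]_(2 * 2)) (m : 'M[C]_2) : Prop :=
  U *m (1%:M *t r) *m U ^t* = m *t 1%:M.

(** The factor one half compensates the trace of the ancilla identity, so that a transfer to [m] has
    [half_bloch] equal to [m]. *)
Definition half_bloch (U : 'M[C]_(2 * 2)) : 'M[C]_2 :=
  2^-1 *: ptraceB (U *m (1%:M *t r) *m U ^t*).

Lemma two_unitC : (2 : C) != 0. Proof. by rewrite pnatr_eq0. Qed.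

Lemma final_stateE U : U \is unitarymx ->
  final_qubit_state rhoB U = 2^-1 *: 1%:M + half_bloch U.
Proof.
move=> Uu; rewrite /final_qubit_state /initial_state rhoE.
rewrite tensmxZl tensmxDr tensmxZr tensmx11 -scalemxAr -scalemxAl.
rewrite mulmxDr mulmxDl ptraceBZ ptraceBD -scalemxAr -scalemxAl mulmx1.
rewrite (unitarymxP Uu) ptraceBZ -tensmx11 ptraceB_tens mxtrace1 scalerA.
by rewrite mulVf ?two_unitC // scale1r scalerDr.
Qed.

Lemma half_bloch_herm U : (half_bloch U) ^t* = half_bloch U.
Proof.
have [rh _ _] := rx.
rewrite /half_bloch adjmxZ fmorphV rmorph_nat -ptraceB_adj; congr (_ *: ptraceB
    _).
by rewrite adjmx_mul (adjmx_mul U) adj_tens adjmx1 rh trmxCK mulmxA.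
Qed.

Lemma transported_tr (U : 'M[C]_(2 * 2)) : U \is unitarymx -> \tr (U *m (1%:M
    *t r) *m U ^t*) = 0.
Proof.
have [_ rt _] := rx.
by move=> Uu; rewrite mxtrace_mulC mulmxA unitarymxV // mul1mx tr_tens rt mulr0.
Qed.

Lemma half_bloch_tr U : U \is unitarymx -> \tr (half_bloch U) = 0.
Proof.
by move=> Uu; rewrite /half_bloch mxtraceZ tr_ptraceB transported_tr // mulr0.
Qed.

Lemma purityE U : U \is unitarymx ->
  qubit_purity rhoB U = 2^-1 + complex.Re (\tr (half_bloch U *m half_bloch U)).
Proof.
move=> Uu; rewrite /qubit_purity final_stateE //; set m := half_bloch U.
have mt : \tr m = 0 by rewrite half_bloch_tr.
rewrite tr_sqr_shift // ReD; congr (_ + _); rewrite divfK ?two_unitC //.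
have -> : (2^-1 : C) = (2^-1)%:C by rewrite fmorphV rmorph_nat.
by [].
Qed.

Lemma transported_sqr (U : 'M[C]_(2 * 2)) : U \is unitarymx ->
  U *m (1%:M *t r) *m U ^t* *m (U *m (1%:M *t r) *m U ^t*) = ((x ^+ 2)%:C)%:M.
Proof.
have [_ _ rr] := rx; move=> Uu.
have -> : U *m (1%:M *t r) *m U ^t* *m (U *m (1%:M *t r) *m U ^t*)
    = U *m (1%:M *t r) *m (U ^t* *m U) *m ((1%:M *t r) *m U ^t*).
  by move: (U ^t*) => U'; rewrite !mulmxA.
rewrite unitarymxV // mulmx1 -mulmxA (mulmxA (1%:M *t r)) tensmx_mul rr mulmx1.
by rewrite tens1_scalar mul_scalarmx_mid (unitarymxP Uu) scalemx1.
Qed.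

(** Expand the squared Frobenius norm: the transported operator squares to [x ^+ 2], and the cross
    term is computed through its partial trace, which is [2 *: m]. *)
Lemma transported_distance (U : 'M[C]_(2 * 2)) (m := half_bloch U)
    (D := U *m (1%:M *t r) *m U ^t* - m *t 1%:M) : U \is unitarymx ->
  \tr (D *m D ^t*) = 4 * (x ^+ 2)%:C - 2 * \tr (m *m m).
Proof.
move=> Uu; have [rh _ _] := rx.
set X := U *m _ *m _ in D *.
have Xh : X ^t* = X.
  by rewrite /X adjmx_mul (adjmx_mul U) adj_tens adjmx1 rh trmxCK mulmxA.
have -> : D ^t* = D by rewrite /D adjmxB Xh adj_tens adjmx1 half_bloch_herm.
have pX : ptraceB X = 2 *: m.
  by rewrite /m /half_bloch scalerA mulfV ?two_unitC // scale1r.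
rewrite /D tr_sqrB transported_sqr // -(tr_ptraceB (X *m _)) ptraceB_mulr pX.
rewrite -scalemxAl mxtraceZ tensmx_mul mulmx1 tr_tens mxtrace1 mxtrace_scalar.
ring.
Qed.

Lemma Re_distance (z : C) :
  complex.Re (4 * (x ^+ 2)%:C - 2 * z) = 4 * x ^+ 2 - 2 * complex.Re z.
Proof.
have nE n : (n%:R : C) = (n%:R)%:C by rewrite rmorph_nat.
by rewrite !nE; case: z => a b; simpc; rewrite /=; ring.
Qed.

Lemma purity_le U : U \is unitarymx -> qubit_purity rhoB U <= 2^-1 + 2 * x ^+ 2.
Proof.
move=> Uu; rewrite purityE // lerD2l.
have := tr_adj_ge0 (U *m (1%:M *t r) *m U ^t* - half_bloch U *t 1%:M).
rewrite transported_distance // Re_distance; lra.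
Qed.

(** Equality in [purity_le] means that the distance in [transported_distance] is zero. *)
Lemma purity_max U : U \is unitarymx -> qubit_purity rhoB U = 2^-1 + 2 * x ^+ 2
    ->
  transfers U (half_bloch U).
Proof.
move=> Uu; rewrite purityE // => /addrI pE.
apply/eqP; rewrite -subr_eq0; apply/eqP; apply: tr_adj_eq0.
rewrite transported_distance // Re_distance pE; lra.
Qed.

Lemma transfers_half_bloch U m : transfers U m -> m = half_bloch U.
Proof.
rewrite /transfers /half_bloch => ->; rewrite ptraceB_tens mxtrace1 scalerA.
by rewrite mulVf ?two_unitC // scale1r.
Qed.

Lemma transfers_sqr U m : U \is unitarymx -> transfers U m -> traceless_herm m
    x.
Proof.
move=> Uu Um; have mE := transfers_half_bloch Um; split.
- by rewrite mE half_bloch_herm.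
- by rewrite mE half_bloch_tr.
have := transported_sqr Uu; rewrite Um tensmx_mul mulmx1 => /(congr1 (@ptraceB
    R)).
rewrite -(tens1_scalar 2 2) !ptraceB_tens mxtrace1 mxtrace_scalar => E.
by apply: (scalerI two_unitC); rewrite E !scalemx1 scale_scalar_mx mulr_natl.
Qed.

Lemma transfers_purity U m : U \is unitarymx -> transfers U m ->
  qubit_purity rhoB U = 2^-1 + 2 * x ^+ 2.
Proof.
move=> Uu Um; have [_ _ mm] := transfers_sqr Uu Um.
rewrite purityE // -(transfers_half_bloch Um) mm mxtrace_scalar; congr (_ + _).
by rewrite -rmorphMn /= mulr2n mulr_natl mulr2n.
Qed.

Lemma transfers_resets U m : SU U -> transfers U m -> resets rhoB U.
Proof.
move=> [Uu Ud] Um; split=> // V [Vu _].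
by rewrite (transfers_purity Uu Um) purity_le.
Qed.

(** One transferring gate [U0] shows that the upper bound on the purity is attained, so every
    maximizer attains it. *)
Lemma resets_transfers U0 m0 U : SU U0 -> transfers U0 m0 -> resets rhoB U ->
  transfers U (half_bloch U).
Proof.
move=> [U0u U0d] U0m [[Uu Ud] Umax]; apply: purity_max => //.
apply/eqP; rewrite eq_le purity_le //= -(transfers_purity U0u U0m).
exact: Umax.
Qed.

End FixedState.
End Purity.

(** * Conjugation in SU(2) and the Pauli algebra *)

Section SU2.
Variable R : realType.
Local Notation C := R[i].

Lemma mulmx_col2E (A : 'M[C]_2) (v : 'cV[C]_2) i :
  (A *m v) i 0 = A i 0 * v 0 0 + A i 1 * v 1 0.
Proof.
rewrite mxE !big_ord_recl big_ord0 addr0; congr (_ + A i _ * v _ 0).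
all: exact: val_inj.
Qed.

Lemma complex_ext (a b : C) : complex.Re a = complex.Re b ->
  complex.Im a = complex.Im b -> a = b.
Proof. by case: a => ? ?; case: b => ? ? /= -> ->. Qed.

Lemma conjcD (a b : C) : Num.conj (a + b) = Num.conj a + Num.conj b.
Proof. exact: rmorphD. Qed.

Lemma conjcM (a b : C) : Num.conj (a * b) = Num.conj a * Num.conj b.
Proof. exact: rmorphM. Qed.

Lemma rdot_gt0 n (v : 'cV[C]_n) : v != 0 -> 0 < rdot v v.
Proof.
move=> v0; rewrite lt_neqAle rdot_ge0 andbT eq_sym; apply: contra v0 => /eqP vv.
apply/eqP; apply: tr_adj_eq0; rewrite mxtrace_mulC /mxtrace big_ord1.
by rewrite -/(rdot v v) vv.
Qed.

(** Since [r] squares to [x ^+ 2], each nonzero column of [r + x] is an eigenvector for [x]; one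
    exists because the trace of [r + x] is [2 x]. *)
Lemma eigenvector2 (r : 'M[C]_2) (x : R) : x != 0 -> traceless_herm r x ->
  exists2 v : 'cV[C]_2, rdot v v = 1 & r *m v = x%:C *: v.
Proof.
move=> x0 [rh rt rr]; pose N := r + (x%:C)%:M.
have rN : r *m N = x%:C *: N.
  rewrite /N mulmxDr rr mul_mx_scalar scalerDr addrC; congr (_ + _).
  by rewrite scale_scalar_mx rmorphXn expr2.
have trN : \tr N != 0.
  rewrite /N mxtraceD rt add0r mxtrace_scalar mulrn_eq0 /=.
  by rewrite fmorph_eq0.
have [j vj] : exists j, col j N != 0.
  apply/existsP; rewrite -negb_forall; apply: contra trN => /forallP N0.
  rewrite (_ : N = 0) ?mxtrace0 //; apply/matrixP => a b.
  by have /eqP /colP /(_ a) := N0 b; rewrite !mxE.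
pose c := (Num.sqrt (rdot (col j N) (col j N)))^-1.
exists (c%:C *: col j N).
  rewrite rdotZl rdotZr mulrA -expr2 exprVn sqr_sqrtr ?rdot_ge0 //.
  by rewrite mulVf // gt_eqF // rdot_gt0.
have colM : r *m col j N = col j (r *m N) by rewrite !colE mulmxA.
rewrite -scalemxAr colM rN scalerA mulrC -scalerA; congr (_ *: _).
by apply/colP => a; rewrite !mxE.
Qed.

Lemma det2 (A : 'M[C]_2) : \det A = A 0 0 * A 1 1 - A 0 1 * A 1 0.
Proof.
rewrite (expand_det_row _ ord0) !big_ord_recl big_ord0 addr0 /cofactor
    !det_mx11.
rewrite !mxE /= expr0 expr1 mul1r mulN1r mulrN.
by congr (A _ _ * A _ _ - A _ _ * A _ _); apply: val_inj.
Qed.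

Lemma SU_mul n (A B : 'M[C]_n) : SU A -> SU B -> SU (A *m B).
Proof.
by move=> [Au Ad] [Bu Bd]; split; [exact: unitarymxM|rewrite det_mulmx Ad Bd
    mulr1].
Qed.

Lemma SU_adj n (A : 'M[C]_n) : SU A -> SU (A ^t*).
Proof.
move=> [Au Ad]; split; first by rewrite trmxC_unitary.
by rewrite det_map_mx det_tr Ad rmorph1.
Qed.

Lemma SU1 n : SU (1%:M : 'M[C]_n).
Proof. by split; [apply/unitarymxP; rewrite adjmx1 mulmx1|rewrite det1]. Qed.

Lemma SU2_diag (r : 'M[C]_2) (x : R) : x != 0 -> traceless_herm r x ->
  exists2 k, SU k & k *m r = x%:C *: pauli R ord_max *m k.
Proof.
move=> x0 rx; have [v v1 rv] := eigenvector2 x0 rx.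
have [rh rt _] := rx.
(* The rows are the adjoints of [v] and of the unit vector orthogonal to it, with the phase of the
   latter chosen to give determinant 1. *)
pose k : 'M[C]_2 := \matrix_(i, j)
  if i == 0 then Num.conj (v j 0) else if j == 0 then - v 1 0 else v 0 0.
have norm1 : Num.conj (v 0 0) * v 0 0 + Num.conj (v 1 0) * v 1 0 = 1.
  have : (v ^t* *m v) 0 0 = 1.
    have : rdot v v = 1 by [].
    rewrite /rdot; case E: (_ 0 0) => [a b] /= ->.
    have : Num.conj ((v ^t* *m v) 0 0) = (v ^t* *m v) 0 0.
      by rewrite -[in RHS](trmxCK v) -adjmx_mul trmxCK !mxE.
    rewrite E => -[bb]; congr (_ +i* _); lra.
  rewrite mxE !big_ord_recl big_ord0 addr0 !mxE.
  by rewrite (_ : lift ord0 ord0 = 1) //; apply: val_inj.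
exists k.
  split.
    apply/unitarymxP; apply: matrix2P; rewrite mulmx2E !mxE /= ?conjCK.
    - exact: norm1.
    - by rewrite rmorphN mulrN mulrC addrC subrr.
    - by rewrite mulNr mulrC addrC subrr.
    - by rewrite rmorphN mulrNN addrC -norm1; congr (_ + _); rewrite mulrC.
  by rewrite det2 !mxE /= mulrN opprK.
have e0 : r 0 0 * v 0 0 + r 0 1 * v 1 0 = x%:C * v 0 0.
  by rewrite -mulmx_col2E rv mxE.
have e1 : r 1 0 * v 0 0 + r 1 1 * v 1 0 = x%:C * v 1 0.
  by rewrite -mulmx_col2E rv mxE.
have E i j : Num.conj (r j i) = r i j by rewrite -[in RHS]rh !mxE.
have r11 : r 1 1 = - r 0 0.
  by apply/eqP; rewrite -addr_eq0 addrC -mxtrace2 rt.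
apply: matrix2P; rewrite !mulmx2E !mxE /= ?mulr0 ?mul0r ?addr0 ?add0r ?mulr1.
- have := congr1 Num.conj e0; rewrite conjcD !conjcM !E conj_realC => <-; ring.
- have := congr1 Num.conj e1; rewrite conjcD !conjcM !E conj_realC => <-; ring.
- rewrite mulrN1 mulrNN -e1 r11; ring.
- rewrite mulrN1 !mulNr -e0 r11; ring.
Qed.

(** Transitivity of SU(2) on a Bloch sphere: both matrices are brought to the same multiple of the
    third Pauli matrix. *)
Lemma SU2_conj (r1 r2 : 'M[C]_2) (x : R) : x != 0 ->
  traceless_herm r1 x -> traceless_herm r2 x ->
  exists2 k, SU k & k *m r1 *m k ^t* = r2.
Proof.
move=> x0 r1x r2x; have [k1 k1S e1] := SU2_diag x0 r1x.
have [k2 k2S e2] := SU2_diag x0 r2x; have [k1u _] := k1S; have [k2u _] := k2S.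
exists (k2 ^t* *m k1); first exact: SU_mul (SU_adj k2S) k1S.
rewrite adjmx_mul trmxCK -(mulmxA (k2 ^t*)) e1.
have -> : k2 ^t* *m (x%:C *: pauli R ord_max *m k1) *m (k1 ^t* *m k2)
  = k2 ^t* *m (x%:C *: pauli R ord_max) *m (k1 *m k1 ^t*) *m k2.
  by move: (k2 ^t*) (k1 ^t*) (_ *: _) => a b c; rewrite !mulmxA.
by rewrite (unitarymxP k1u) mulmx1 -mulmxA -e2 mulmxA unitarymxV // mul1mx.
Qed.

Lemma pauli_traceless_herm (k : 'I_3) (x : R) : traceless_herm (x%:C *: pauli R
    k) x.
Proof.
split; first by rewrite adjmxZ conj_realC pauli_herm.
  by rewrite mxtraceZ pauli_tr mulr0.
rewrite -scalemxAl -scalemxAr pauli_sqr scalerA -rmorphM -expr2.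
by rewrite scale_scalar_mx mulr1.
Qed.

(** The factor is [i] or [- i] by the orientation of the triple; its square, the same for both,
    removes the orientation in [pauli2_product]. *)
Lemma pauli_mul (p q j : 'I_3) : p != q -> q != j -> j != p ->
  exists2 lam : C, lam * lam = -1 & pauli R q *m pauli R p = lam *: pauli R j.
Proof.
have ii : ('i%C * 'i%C : C) = -1 by rewrite -expr2 sqr_i.
elim/ord3P: p; elim/ord3P: q; elim/ord3P: j => // _ _ _.
all: first [exists 'i%C; [exact: ii | apply: matrix2P; rewrite mulmx2E !mxE /=;
       apply/eqP; rewrite eq_complex /=; apply/andP; split; apply/eqP; ring]
  | exists (- 'i%C); [by rewrite mulrNN | apply: matrix2P; rewrite mulmx2E !mxE
      /=;
       apply/eqP; rewrite eq_complex /=; apply/andP; split; apply/eqP; ring]].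
Qed.

Lemma pauli_anticomm (p q : 'I_3) : p != q ->
  pauli R p *m pauli R q = - (pauli R q *m pauli R p).
Proof.
elim/ord3P: p; elim/ord3P: q => // _.
all: apply: matrix2P; rewrite !(mulmx2E, mxE) /=.
all: apply/eqP; rewrite eq_complex /=; apply/andP; split; apply/eqP; ring.
Qed.

Lemma traceless_herm_pauli (r : 'M[C]_2) (x : R) : traceless_herm r x ->
  exists2 y : 'I_3 -> R, r = \sum_j (y j)%:C *: pauli R j & x ^+ 2 = \sum_j y j
      ^+ 2.
Proof.
move=> [rh rt rr].
have E i j : Num.conj (r j i) = r i j by rewrite -[in RHS]rh !mxE.
have r00 : r 0 0 = - r 1 1.
  by apply/eqP; rewrite -addr_eq0 -mxtrace2 rt.
have := E 1 1; have := E 0 1.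
have := congr1 (fun A : 'M[C]_2 => A 0 0) rr; rewrite mulmx2E mxE mulr1n r00.
case e11: (r 1 1) => [a b]; case e10 : (r 1 0) => [c d].
move=> + /esym e01 [bb]; have {bb}b0 : b = 0 by lra.
have {}e01 : r 0 1 = c -i* d := e01.
rewrite e01 b0 => -[xx _].
(* Bloch coordinates read off from the lower row [c + i d], [a] of [r]. *)
exists (fun k => if k == ord0 then c else if k == ord_max then - a else d).
  rewrite !big_ord_recl big_ord0 addr0.
  apply: matrix2P; rewrite !mxE /= ?r00 ?e01 ?e10 ?e11 ?b0;
    by apply: complex_ext => /=; ring.
rewrite !big_ord_recl big_ord0 /= -xx; ring.
Qed.

End SU2.

(** * Canonical gates *)

Section AntiInvolution.
Variables (T : comNzRingType) (n : nat).

(* [rot a b S] is [a + b S]; for an involution [S] and [a = cos t],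
   [b = i sin t] it is the rotation [exp (i t S)]. *)
Definition rot (a b : T) (S : 'M[T]_n) : 'M[T]_n := a%:M + b *: S.

Lemma rot_comm a b c d (S S' : 'M[T]_n) : S *m S' = S' *m S ->
  rot a b S *m rot c d S' = rot c d S' *m rot a b S.
Proof.
move=> SS; rewrite /rot !mulmxDl !mulmxDr !mul_scalar_mx !mul_mx_scalar.
rewrite -!scalemxAl -!scalemxAr SS !scalerA ![d * _]mulrC.
rewrite !scale_scalar_mx (mulrC c a) -!addrA; congr (_ + _).
by rewrite addrCA.
Qed.

Lemma rot_anticomm a b (S N : 'M[T]_n) : S *m N = - (N *m S) ->
  N *m rot a (- b) S = rot a b S *m N.
Proof.
move=> SN; rewrite /rot mulmxDr mulmxDl mul_scalar_mx mul_mx_scalar.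
by rewrite -scalemxAr -scalemxAl SN scaleNr scalerN.
Qed.

Lemma rot_comm1 a b (S N : 'M[T]_n) : S *m N = N *m S ->
  N *m rot a b S = rot a b S *m N.
Proof.
move=> SN; rewrite /rot mulmxDr mulmxDl mul_scalar_mx mul_mx_scalar.
by rewrite -scalemxAr -scalemxAl SN.
Qed.

Lemma rot_mul a b c d (S : 'M[T]_n) : S *m S = 1%:M ->
  rot a b S *m rot c d S = rot (a * c + b * d) (a * d + b * c) S.
Proof.
move=> SS; rewrite /rot !mulmxDl !mulmxDr !mul_scalar_mx !mul_mx_scalar.
rewrite -!scalemxAl -!scalemxAr SS !scalerA scale_scalar_mx raddfD /= scalerDl.
by rewrite ?scale_scalar_mx ?mulr1 [X in _ + X = _]addrC addrACA (mulrC c b).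
Qed.

Lemma rot10 (S : 'M[T]_n) : rot 1 0 S = 1%:M.
Proof. by rewrite /rot scale0r addr0. Qed.

End AntiInvolution.

(** * Rotations generated by Pauli products, and the Bell basis *)

Section Gate.
Variable R : realType.
Local Notation C := R[i].
Local Notation sg := (pauli R).

Definition pauli2 (k : 'I_3) : 'M[C]_(2 * 2) := sg k *t sg k.

Definition irot (t : R) (S : 'M[C]_(2 * 2)) := rot (cos t)%:C ('i%C * (sin
    t)%:C) S.

Lemma pauli2_sqr k : pauli2 k *m pauli2 k = 1%:M.
Proof. by rewrite tensmx_mul !pauli_sqr tensmx11. Qed.

Lemma tensNN (A B : 'M[C]_2) : (- A) *t (- B) = A *t B.
Proof. by apply/matrixP => i j; rewrite !mxE mulrNN. Qed.

Lemma tensNr (A B : 'M[C]_2) : A *t (- B) = - (A *t B).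
Proof. by apply/matrixP => i j; rewrite !mxE mulrN. Qed.

Lemma tensNl (A B : 'M[C]_2) : (- A) *t B = - (A *t B).
Proof. by apply/matrixP => i j; rewrite !mxE mulNr. Qed.

Lemma pauli2_comm k l : pauli2 k *m pauli2 l = pauli2 l *m pauli2 k.
Proof.
have [->//|kl] := eqVneq k l.
by rewrite !tensmx_mul (pauli_anticomm R kl) tensNN.
Qed.

Lemma pauli2_herm k : (pauli2 k) ^t* = pauli2 k.
Proof. by rewrite adj_tens pauli_herm. Qed.

Lemma irot_adj t S : S ^t* = S -> (irot t S) ^t* = irot (- t) S.
Proof.
move=> Sh; rewrite /irot /rot adjmxD adjmxZ Sh conjcM conj_realC cosN sinN.
congr (_ + _ *: _); first by rewrite tr_scalar_mx map_scalar_mx /= conj_realC.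
by apply: complex_ext => /=; ring.
Qed.

Lemma irot_mul s t S : S *m S = 1%:M -> irot s S *m irot t S = irot (s + t) S.
Proof.
move=> SS; rewrite /irot (rot_mul _ _ _ _ SS) cosD sinD; congr (rot _ _ _).
  by apply: complex_ext => /=; ring.
by apply: complex_ext => /=; ring.
Qed.

Lemma irot0 S : irot 0 S = 1%:M.
Proof. by rewrite /irot cos0 sin0 rmorph0 mulr0 rot10. Qed.

Lemma irot_unitary t S : S ^t* = S -> S *m S = 1%:M -> irot t S \is unitarymx.
Proof.
by move=> Sh SS; apply/unitarymxP; rewrite irot_adj // irot_mul // subrr irot0.
Qed.

Lemma irot_conj_comm t S N : S ^t* = S -> S *m S = 1%:M -> S *m N = N *m S ->
  irot t S *m N *m (irot t S) ^t* = N.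
Proof.
move=> Sh SS SN; rewrite -(rot_comm1 _ _ SN) -mulmxA.
by rewrite (unitarymxP (irot_unitary t Sh SS)) mulmx1.
Qed.

(** Moving the inverse rotation past an anticommuting [N] inverts it again, so the two half-angle
    rotations combine instead of cancelling. *)
Lemma irot_conj_anticomm t S N : S ^t* = S -> S *m S = 1%:M ->
  S *m N = - (N *m S) -> irot (t / 2) S *m N *m (irot (t / 2) S) ^t* = irot t S
      *m N.
Proof.
have -> : irot t S = irot (t / 2 + t / 2) S by rewrite -splitr.
move: (t / 2) => {}t Sh SS SN; rewrite irot_adj // -mulmxA.
have -> : N *m irot (- t) S = irot t S *m N.
  by rewrite /irot cosN sinN rmorphN mulrN; apply: rot_anticomm.
exact: etrans (mulmxA _ _ _) (congr1 (mulmx^~ N) (irot_mul t t SS)).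
Qed.

Definition sgz_row : 'rV[R]_2 := \row_i (if i == 0 then 1 else -1).

Lemma pauliz_diag : sg ord_max = diag_mx (cmx sgz_row).
Proof.
apply: matrix2P; rewrite !mxE /= ?mulr0n ?mulr1n ?rmorph1 ?rmorphN1 //.
Qed.

(* Eigenvalues of [pauli2 k] in the Bell basis *)
Definition bell_sign (k : 'I_3) : 'rV[R]_(2 * 2) := \row_l
  (if k == ord0 then sgz_row 0 (mxtens_unindex l).1
   else if k == ord_max then sgz_row 0 (mxtens_unindex l).1 * sgz_row 0
       (mxtens_unindex l).2
   else - sgz_row 0 (mxtens_unindex l).2).

(* [sqrt 2] times the reflection exchanging the computational and Bell bases *)
Definition bell : 'M[C]_(2 * 2) := sg ord0 *t sg ord0 + sg ord_max *t 1%:M.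

Lemma sgz_row_sqr i : sgz_row 0 i ^+ 2 = 1.
Proof. by rewrite mxE; case: ifP; rewrite ?sqrrN expr1n. Qed.

Lemma bell_sign_sqr k l : bell_sign k 0 l ^+ 2 = 1.
Proof.
rewrite mxE; case: ifP => _; first exact: sgz_row_sqr.
by case: ifP => _; rewrite ?sqrrN ?exprMn !sgz_row_sqr ?mulr1.
Qed.

Lemma bell_sqr : bell *m bell = 2%:M.
Proof.
rewrite /bell mulmxDl !mulmxDr !tensmx_mul !pauli_sqr !mulmx1 !mul1mx tensmx11.
rewrite (@pauli_anticomm R ord0 ord_max) // tensNl addrA addrNK.
by rewrite -raddfD.
Qed.

Lemma diag_bell_sign k : diag_mx (cmx (bell_sign k)) =
  if k == ord0 then sg ord_max *t 1%:M
  else if k == ord_max then sg ord_max *t sg ord_max else - (1%:M *t sg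
      ord_max).
Proof.
have tE (x y : 'rV[C]_2) : cmx (bell_sign k)
    = \row_l (x 0 (mxtens_unindex l).1 * y 0 (mxtens_unindex l).2) ->
    diag_mx (cmx (bell_sign k)) = diag_mx x *t diag_mx y.
  by move=> ->; rewrite tens_diag.
elim/ord3P: k tE => /= tE.
- rewrite pauliz_diag -diag_const_mx; apply: tE; apply/rowP => l.
  by rewrite [RHS]mxE [const_mx _ _ _]mxE mulr1 !mxE.
- rewrite -tensNr pauliz_diag -diag_const_mx -raddfN; apply: tE; apply/rowP =>
    l.
  by rewrite [RHS]mxE [const_mx _ _ _]mxE mul1r !mxE /= rmorphN.
rewrite pauliz_diag; apply: tE; apply/rowP => l.
by rewrite [RHS]mxE mxE [in LHS]mxE /= rmorphM /=; congr (_ * _); rewrite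
    [RHS]mxE.
Qed.

(** The three commuting Pauli products are diagonalized simultaneously, which turns the canonical
    gate into a matrix of phases. *)
Lemma pauli2_bell k : pauli2 k *m bell = bell *m diag_mx (cmx (bell_sign k)).
Proof.
have yx : sg (lift ord0 ord0) *m sg ord0 = (- 'i%C) *: sg ord_max.
  by apply: matrix2P; rewrite mulmx2E !mxE /=; apply: complex_ext => /=; ring.
have yz : sg (lift ord0 ord0) *m sg ord_max = 'i%C *: sg ord0.
  by apply: matrix2P; rewrite mulmx2E !mxE /=; apply: complex_ext => /=; ring.
have xz : sg ord0 *m sg ord_max = (- 'i%C) *: sg (lift ord0 ord0).
  by apply: matrix2P; rewrite mulmx2E !mxE /=; apply: complex_ext => /=; ring.
have ii : (- 'i%C) * (- 'i%C) = -1 :> C by rewrite mulrNN -expr2 sqr_i.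
rewrite diag_bell_sign /pauli2 /bell mulmxDr; elim/ord3P: k => /=.
- rewrite mulmxDl !tensmx_mul !mulmx1 !pauli_sqr tensmx11.
  by rewrite addrC.
- rewrite mulmxN mulmxDl !tensmx_mul !mulmx1 mul1mx yx yz xz.
  rewrite !tensmxZl !tensmxZr scalerA ii scaleN1r opprD addrC scaleNr opprK.
  by [].
rewrite mulmxDl !tensmx_mul !mulmx1 mul1mx.
by rewrite (pauli_anticomm R (_ : ord0 != ord_max)) // tensNN.
Qed.

End Gate.

Lemma sum_ord3 (V : nmodType) (p q j : 'I_3) (f : 'I_3 -> V) :
  p != q -> q != j -> j != p -> \sum_k f k = f p + f q + f j.
Proof.
move=> pq qj jp; rewrite (bigD1 p) //= (bigD1 q) /=; last by rewrite eq_sym.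
rewrite (bigD1 j) /=; last by rewrite jp eq_sym.
rewrite big1 ?addr0 ?addrA // => k.
by move: pq qj jp; elim/ord3P: p; elim/ord3P: q; elim/ord3P: j; elim/ord3P: k.
Qed.

Lemma diag_mxZ (T : comNzRingType) n (a : T) (d : 'rV[T]_n) :
  diag_mx (a *: d) = a *: diag_mx d.
Proof. by apply/matrixP => i j; rewrite !mxE mulrnAr. Qed.

Lemma mulmx_sum_mid (T : comNzRingType) n (I : finType) (A B : 'M[T]_n)
    (x : I -> T) (D : I -> 'M[T]_n) :
  A *m (\sum_k x k *: D k) *m B = \sum_k x k *: (A *m D k *m B).
Proof.
rewrite mulmx_sumr mulmx_suml; apply: eq_bigr => k _.
by rewrite -scalemxAr -scalemxAl.
Qed.

Lemma conj_chain (T : comNzRingType) n (gp gq gj gp' gq' gj' rp rq N : 'M[T]_n)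
    :
  gj *m N *m gj' = N -> gq *m N *m gq' = rq *m N -> gp *m N *m gp' = rp *m N ->
  gp *m rq = rq *m gp ->
  gp *m (gq *m (gj *m N *m gj') *m gq') *m gp' = rq *m (rp *m N).
Proof.
by move=> -> -> ep pq; rewrite mulmxA pq -!mulmxA (mulmxA gp) ep.
Qed.

Lemma rot_mid (T : comNzRingType) n (A B D : 'M[T]_n) (x y : T) : A *m B = 1%:M
    ->
  A *m rot x y D *m B = rot x y (A *m D *m B).
Proof.
move=> AB; rewrite /rot mulmxDr mulmxDl mul_mx_scalar -scalemxAl AB scalemx1.
by rewrite -scalemxAr -scalemxAl.
Qed.

Lemma rot_rot (T : comNzRingType) n (a b c d : T) (S S' N : 'M[T]_n) :
  rot a b S *m (rot c d S' *m N) = (a * c) *: N + (a * d) *: (S' *m N)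
    + ((b * c) *: (S *m N) + (b * d) *: (S *m (S' *m N))).
Proof.
by rewrite /rot !mulmxDl !mulmxDr !mul_scalar_mx -!scalemxAl -!scalemxAr
    !scalerA.
Qed.

(** * Flows generated by Hermitian involutions *)

Section InvolutionFlow.
Variable R : realType.
Local Notation C := R[i].

Lemma diag_phases_sign n (t : R) (e : 'rV[R]_n) :
  (forall l, e 0 l = 1 \/ e 0 l = -1) ->
  diag_mx (phases (t *: e)) = rot (cos t)%:C ('i%C * (sin t)%:C) (diag_mx (cmx
      e)).
Proof.
move=> sgn; apply/matrixP => a b; rewrite /rot !mxE.
case: (a == b); last by rewrite !mulr0n mulr0 addr0.
rewrite !mulr1n; case: (sgn a) => ->; rewrite /cis ?mulr1 ?mulrN1 ?cosN ?sinN;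
  by apply: complex_ext => /=; ring.
Qed.

(** The eigenvalues are signs, for which the phase [exp (i t d)] equals [cos t + i d sin t]; hence
    the flow is the rotation [irot]. *)
Lemma involution_diagonal (S : 'M[C]_(2 * 2)) : S ^t* = S -> S *m S = 1%:M ->
  exists P d, [/\ P \is unitarymx, S = P ^t* *m diag_mx (cmx d) *m P &
    forall t, irot t S = flow P d t].
Proof.
move=> Sh SS; have [P [d [Pu SE]]] := hermitian_diagonal Sh.
have dd l : d 0 l = 1 \/ d 0 l = -1.
  apply/pred2P; rewrite -eqf_sqr expr1n; apply/eqP.
  have DE : diag_mx (cmx d) = P *m S *m P ^t*.
    have := unitarymxP Pu; rewrite SE; move: (P ^t*) (diag_mx _) => Q D PQ.
    by rewrite !mulmxA PQ mul1mx -mulmxA PQ mulmx1.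
  have : diag_mx (cmx d) *m diag_mx (cmx d) = 1%:M.
    have := unitarymxV Pu; have := unitarymxP Pu; rewrite DE.
    move: (P ^t*) => Q PQ QP; rewrite !mulmxA -(mulmxA _ Q P) QP mulmx1.
    by rewrite -(mulmxA P) SS mulmx1 PQ.
  move=> /matrixP /(_ l l); rewrite mulmx_diag !mxE eqxx !mulr1n -rmorphM.
  by move=> [<-]; rewrite expr2.
exists P, d; split=> // t; rewrite /flow (diag_phases_sign t dd).
by rewrite (rot_mid _ _ _ (unitarymxV Pu)) /irot SE.
Qed.

Lemma mexp_involution (S : 'M[C]_(2 * 2)) (J s : R) : S ^t* = S -> S *m S =
    1%:M ->
  mexp ((- 'i%C * s%:C) *: (J%:C *: S)) = irot (- (s * J)) S.
Proof.
move=> Sh SS; have [P [d [Pu SE flowE]]] := involution_diagonal Sh SS.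
have dE : - (s * J) *: d = - s *: (J *: d) by rewrite scalerA mulNr.
rewrite flowE SE /flow dE -(hermitian_flow _ _ Pu); congr (mexp (_ *: _)).
have -> : map_mx (real_complex R) (J *: d) = J%:C *: cmx d.
  by apply/rowP => l; rewrite !mxE rmorphM.
by rewrite diag_mxZ -scalemxAr -scalemxAl.
Qed.

(** The determinant is the phase of angle [t] times the trace of [S]. *)
Lemma irot_SU t (S : 'M[C]_(2 * 2)) : S ^t* = S -> S *m S = 1%:M -> \tr S = 0 ->
  SU (irot t S).
Proof.
move=> Sh SS trS; split; first exact: irot_unitary.
have [P [d [Pu SE ->]]] := involution_diagonal Sh SS.
rewrite /flow !det_mulmx mulrAC -det_mulmx unitarymxV // det1 mul1r det_diag.
under eq_bigr do rewrite !mxE.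
rewrite -cis_sum -mulr_sumr (_ : \sum_i d 0 i = 0) ?mulr0 ?cis0 //.
move: trS; rewrite SE mxtrace_mulC mulmxA (unitarymxP Pu) mul1mx mxtrace_diag.
under eq_bigr do rewrite mxE.
by rewrite -rmorph_sum => -[].
Qed.

End InvolutionFlow.

(** * Action of the canonical gate on ancilla operators *)

Section GateAction.
Variable R : realType.
Local Notation C := R[i].
Local Notation sg := (pauli R).
Local Notation S_ := (pauli2 R).

Definition bell_inv : 'M[C]_(2 * 2) := 2^-1 *: bell R.

Lemma bell_invl : bell_inv *m bell R = 1%:M.
Proof. by rewrite -scalemxAl bell_sqr scale_scalar_mx mulVf ?two_unitC. Qed.

Lemma bell_invr : bell R *m bell_inv = 1%:M.
Proof. by rewrite -scalemxAr bell_sqr scale_scalar_mx mulVf ?two_unitC. Qed.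

Lemma pauli2_diag k : S_ k = bell R *m diag_mx (cmx (bell_sign R k)) *m
    bell_inv.
Proof. by rewrite -pauli2_bell -mulmxA bell_invr mulmx1. Qed.

Lemma bell_signP k l : bell_sign R k 0 l = 1 \/ bell_sign R k 0 l = -1.
Proof. by apply/pred2P; rewrite -eqf_sqr bell_sign_sqr expr1n. Qed.

Lemma irot_bell (t : R) k : irot t (S_ k)
  = bell R *m diag_mx (phases (t *: bell_sign R k)) *m bell_inv.
Proof.
rewrite (diag_phases_sign t (bell_signP k)) (rot_mid _ _ _ bell_invr).
by rewrite /irot pauli2_diag.
Qed.

Lemma canonical_gate_bell (c : 'I_3 -> R) : canonical_gate c
  = bell R *m diag_mx (phases (\sum_k (c k / 2) *: bell_sign R k)) *m bell_inv.
Proof.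
rewrite -mexp_diag; last exact: bell_invl.
congr mexp.
have -> : \sum_k (c k)%:C *: (sg k *t sg k)
   = bell R *m (\sum_k (c k)%:C *: diag_mx (cmx (bell_sign R k))) *m bell_inv.
  by rewrite mulmx_sum_mid; apply: eq_bigr => k _; rewrite -pauli2_diag.
set D := \sum_k _ *: diag_mx _.
have -> : diag_mx ('i%C *: map_mx (real_complex R) (\sum_k (c k / 2) *:
    bell_sign R k))
   = ('i%C / 2) *: D.
  rewrite /D scaler_sumr -[LHS]/(diag_mx _).
  have -> : 'i%C *: map_mx (real_complex R) (\sum_k (c k / 2) *: bell_sign R k)
     = \sum_k (('i%C / 2) * (c k)%:C) *: cmx (bell_sign R k).
    rewrite raddf_sum scaler_sumr; apply: eq_bigr => k _.
    move: (bell_sign R k) => e; apply/rowP => l; rewrite !mxE.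
    have -> : (2^-1 : C) = (2^-1)%:C by rewrite fmorphV rmorph_nat.
    by apply: complex_ext => /=; ring.
  rewrite raddf_sum; apply: eq_bigr => k _.
  rewrite scalerA; exact: diag_mxZ.
move: (bell R) bell_inv D => A B D.
by rewrite -scalemxAr -scalemxAl.
Qed.

(** In the Bell basis all factors are diagonal and their phases add, so the exponential splits in
    any order of the indices. *)
Lemma canonical_gateE (c : 'I_3 -> R) (p q j : 'I_3) :
  p != q -> q != j -> j != p ->
  canonical_gate c = irot (c p / 2) (S_ p) *m irot (c q / 2) (S_ q)
                     *m irot (c j / 2) (S_ j).
Proof.
move=> pq qj jp; rewrite canonical_gate_bell (sum_ord3 _ pq qj jp) !irot_bell.
have phM (x y : 'rV[R]_(2 * 2)) : bell R *m diag_mx (phases x) *m bell_inv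
    *m (bell R *m diag_mx (phases y) *m bell_inv)
    = bell R *m diag_mx (phases (x + y)) *m bell_inv.
  have -> : diag_mx (phases (x + y)) = diag_mx (phases x) *m diag_mx (phases y).
    rewrite mulmx_diag; congr diag_mx; apply/rowP => l.
    by rewrite !mxE cisD.
  have := bell_invl; move: (bell R) bell_inv (diag_mx _) (diag_mx _) => A B D E
      BA.
  by rewrite !mulmxA -[in LHS](mulmxA _ B) BA mulmx1.
by rewrite !phM.
Qed.

Lemma anc_anticomm k j : k != j ->
  S_ k *m (1%:M *t sg j) = - ((1%:M *t sg j) *m S_ k).
Proof.
by move=> kj; rewrite !tensmx_mul mulmx1 mul1mx (pauli_anticomm R kj) tensNr.
Qed.

Lemma anc_comm j : S_ j *m (1%:M *t sg j) = (1%:M *t sg j) *m S_ j.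
Proof. by rewrite !tensmx_mul mulmx1 mul1mx. Qed.

Lemma conj_mulM (A B N : 'M[C]_(2 * 2)) :
  A *m B *m N *m (A *m B) ^t* = A *m (B *m N *m B ^t*) *m A ^t*.
Proof.
by rewrite adjmx_mul; move: (A ^t*) (B ^t*) => a b; rewrite !mulmxA.
Qed.

(** The factor of index [j] commutes with the operator and drops out; the other two anticommute with
    it, and their half angles double. *)
Lemma gate_conj (c : 'I_3 -> R) (p q j : 'I_3) :
  p != q -> q != j -> j != p ->
  canonical_gate c *m (1%:M *t sg j) *m (canonical_gate c) ^t*
  = irot (c q) (S_ q) *m (irot (c p) (S_ p) *m (1%:M *t sg j)).
Proof.
move=> pq qj jp; rewrite (canonical_gateE c pq qj jp) !conj_mulM.
have pj : p != j by rewrite eq_sym.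
apply: conj_chain.
- exact: irot_conj_comm (pauli2_herm _ _) (pauli2_sqr _ _) (anc_comm _).
- exact: irot_conj_anticomm (pauli2_herm _ _) (pauli2_sqr _ _) (anc_anticomm
    qj).
- exact: irot_conj_anticomm (pauli2_herm _ _) (pauli2_sqr _ _) (anc_anticomm
    pj).
exact: rot_comm (pauli2_comm _ _ _).
Qed.

Lemma pauli2_product (p q j : 'I_3) : p != q -> q != j -> j != p ->
  S_ q *m (S_ p *m (1%:M *t sg j)) = - (sg j *t 1%:M).
Proof.
move=> pq qj jp; have [lam ll qpE] := pauli_mul R pq qj jp.
rewrite mulmxA !tensmx_mul mulmx1 qpE -scalemxAl pauli_sqr tensmxZl tensmxZr.
by rewrite scalerA ll scaleN1r.
Qed.

Lemma pauli2_anc k j : S_ k *m (1%:M *t sg j) = sg k *t (sg k *m sg j).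
Proof. by rewrite tensmx_mul mulmx1. Qed.

(** Of the four terms of the product of rotations, three are traceless on the ancilla. The one with
    both sines survives, the sign of [i ^ 2] cancelling that of [pauli2_product]. *)
Lemma gate_conj_ptrace (c : 'I_3 -> R) (p q j : 'I_3) :
  p != q -> q != j -> j != p ->
  ptraceB (canonical_gate c *m (1%:M *t sg j) *m (canonical_gate c) ^t*)
  = (2 * (sin (c p) * sin (c q)))%:C *: sg j.
Proof.
move=> pq qj jp; rewrite (gate_conj c pq qj jp) /irot rot_rot.
have lin (a b d e : C) (A B D E : 'M[C]_(2 * 2)) :
    ptraceB (a *: A + b *: B + (d *: D + e *: E)) = a *: ptraceB A
      + b *: ptraceB B + (d *: ptraceB D + e *: ptraceB E).
  by rewrite !ptraceBD !ptraceBZ.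
rewrite lin (pauli2_product pq qj jp) !pauli2_anc.
have trM k l : k != l -> \tr (sg k *m sg l) = 0.
  move=> kl; have := mxtrace_mulC (sg k) (sg l).
  rewrite (pauli_anticomm R kl) raddfN /= => /eqP.
  by rewrite eq_sym -addr_eq0 -mulr2n mulrn_eq0 /= => /eqP ->; rewrite oppr0.
have pj : p != j by rewrite eq_sym.
rewrite !ptraceB_tens pauli_tr (trM _ _ qj) (trM _ _ pj) !scale0r !scaler0
    !add0r.
rewrite -scaleN1r ptraceBZ ptraceB_tens mxtrace1 !scalerA; congr (_ *: _).
have -> : (2%:R : C) = (2%:R)%:C by rewrite rmorph_nat.
by apply: complex_ext => /=; ring.
Qed.

Lemma gate_conj_half_pi (c : 'I_3 -> R) (p q j : 'I_3) :
  p != q -> q != j -> j != p -> c p = pi / 2 -> c q = pi / 2 ->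
  canonical_gate c *m (1%:M *t sg j) *m (canonical_gate c) ^t* = sg j *t 1%:M.
Proof.
move=> pq qj jp cp cq; rewrite (gate_conj c pq qj jp) /irot rot_rot.
rewrite (pauli2_product pq qj jp) cp cq cos_pihalf sin_pihalf.
rewrite !rmorph0 !mul0r mulr0 !scale0r !add0r rmorph1 mulr1 -expr2 sqr_i.
by rewrite scaleN1r opprK.
Qed.

Lemma canonical_gate_SU (c : 'I_3 -> R) : SU (canonical_gate c).
Proof.
have Su k t : SU (irot t (S_ k)).
  apply: irot_SU (pauli2_herm _ _) (pauli2_sqr _ _) _.
  by rewrite tr_tens pauli_tr mulr0.
rewrite (@canonical_gateE c ord0 (lift ord0 ord0) ord_max) //.
exact: SU_mul (SU_mul (Su _ _) (Su _ _)) (Su _ _).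
Qed.

End GateAction.

(** * Gates transferring the ancilla state to the qubit *)

(** With [other2 j], the two indices different from [j], in increasing order. *)
Definition other1 (j : 'I_3) : 'I_3 := if j == ord0 then lift ord0 ord0 else
    ord0.
Definition other2 (j : 'I_3) : 'I_3 :=
  if j == ord_max then lift ord0 ord0 else ord_max.

Lemma other12 j : other1 j != other2 j.
Proof. by elim/ord3P: j. Qed.

Lemma other2j j : other2 j != j.
Proof. by elim/ord3P: j. Qed.

Lemma other1j j : j != other1 j.
Proof. by elim/ord3P: j. Qed.

Lemma other_cases j k : k != j -> k = other1 j \/ k = other2 j.
Proof. by elim/ord3P: j; elim/ord3P: k => //= _; by [left|right]. Qed.

Lemma unitary_adj (C : numClosedFieldType) n (A : 'M[C]_n) :
  A \is unitarymx -> A ^t* \is unitarymx.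
Proof. by rewrite trmxC_unitary. Qed.

Section Transfer.
Variable R : realType.
Local Notation C := R[i].
Local Notation sg := (pauli R).

Lemma transfers_left (r : 'M[C]_2) U m (a b : 'M[C]_2) : b \is unitarymx ->
  transfers r U m -> transfers r ((a *t b) *m U) (a *m m *m a ^t*).
Proof.
move=> bu Um; rewrite /transfers conj_mulM Um adj_tens !tensmx_mul mulmx1.
by rewrite (unitarymxP bu).
Qed.

Lemma transfers_right (r : 'M[C]_2) U m (a b : 'M[C]_2) : a \is unitarymx ->
  transfers (b *m r *m b ^t*) U m -> transfers r (U *m (a *t b)) m.
Proof.
move=> au Um; rewrite /transfers conj_mulM adj_tens !tensmx_mul mulmx1.
by rewrite (unitarymxP au).
Qed.

(** Undoing the local factors leaves the bare gate, with [r] rotated by the right ancilla factor and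
    the target by the left qubit factor. *)
Lemma transfers_strip (r : 'M[C]_2) U m (a b a' b' : 'M[C]_2) :
  a \is unitarymx -> b \is unitarymx -> a' \is unitarymx -> b' \is unitarymx ->
  transfers r ((a *t b) *m U *m (a' *t b')) m ->
  transfers (b' *m r *m b' ^t*) U (a ^t* *m m *m a).
Proof.
move=> au bu au' bu' Um.
have ub := unitary_adj bu.
have ua' := unitary_adj au'.
have := transfers_left (a ^t*) ub Um; rewrite trmxCK => H.
have E : (a ^t* *t b ^t*) *m ((a *t b) *m U *m (a' *t b')) = U *m (a' *t b').
  have K1 : (a ^t* *t b ^t*) *m (a *t b) = 1%:M.
    by rewrite tensmx_mul !unitarymxV // tensmx11.
  move: K1; move: (a ^t* *t b ^t*) (a *t b) (a' *t b') => X Y Z XY.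
  by rewrite !mulmxA XY mul1mx.
rewrite E in H.
have F : U = U *m (a' *t b') *m (a' ^t* *t b' ^t*).
  by rewrite -mulmxA tensmx_mul (unitarymxP au') (unitarymxP bu') tensmx11
      mulmx1.
rewrite F; apply: transfers_right ua' _; rewrite trmxCK.
have -> : b' ^t* *m (b' *m r *m b' ^t*) *m b' = r.
  have := unitarymxV bu'; move: (b' ^t*) => X XY.
  by rewrite !mulmxA XY mul1mx -mulmxA XY mulmx1.
exact: H.
Qed.

Lemma gate_transfer (x : R) (c : 'I_3 -> R) j : (forall k, k != j -> c k = pi /
    2) ->
  transfers (x%:C *: sg j) (canonical_gate c) (x%:C *: sg j).
Proof.
move=> cj; rewrite /transfers tensmxZr -scalemxAr -scalemxAl tensmxZl.
congr (_ *: _); apply: gate_conj_half_pi (other12 j) (other2j j) (other1j j) _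
    _.
  by apply: cj; rewrite eq_sym other1j.
by apply: cj; rewrite other2j.
Qed.

Lemma pauli_sum_sqr (z : 'I_3 -> R) :
  (\sum_j (z j)%:C *: sg j) *m (\sum_j (z j)%:C *: sg j)
  = ((\sum_j z j ^+ 2)%:C)%:M.
Proof.
rewrite !big_ord_recl !big_ord0 !addr0.
by apply: matrix2P; rewrite mulmx2E !mxE /=; apply: complex_ext => /=; ring.
Qed.

Lemma gate_half_bloch (c y : 'I_3 -> R) :
  half_bloch (\sum_j (y j)%:C *: sg j) (canonical_gate c)
  = \sum_j (y j * (sin (c (other1 j)) * sin (c (other2 j))))%:C *: sg j.
Proof.
have tsum : (1%:M : 'M[C]_2) *t (\sum_j (y j)%:C *: sg j) =
      \sum_j (y j)%:C *: ((1%:M : 'M[C]_2) *t sg j).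
  rewrite (big_morph (fun A => 1%:M *t A) (@tensmxDr _ _ _ _ _ _) (tensmx0 _)).
  by apply: eq_bigr => j _; rewrite tensmxZr.
have psum (F : 'I_3 -> 'M[C]_(2 * 2)) : ptraceB (\sum_j F j) = \sum_j ptraceB
    (F j).
  apply: (big_morph _ (@ptraceBD R)).
  by rewrite -[0 in LHS](scale0r 0) ptraceBZ scale0r.
rewrite /half_bloch tsum mulmx_sum_mid psum scaler_sumr; apply: eq_bigr => j _.
rewrite ptraceBZ (gate_conj_ptrace c (other12 j) (other2j j) (other1j j))
    !scalerA.
congr (_ *: _); have -> : (2^-1 : C) = (2^-1)%:C by rewrite fmorphV rmorph_nat.
by apply: complex_ext => /=; field.
Qed.

Lemma sin_eq1_range (t : R) : 0 <= t <= pi -> sin t ^+ 2 = 1 -> t = pi / 2.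
Proof.
move=> tr s1; have pi0 := pi_gt0 R.
have c0 : cos t = 0.
  by apply/eqP; rewrite -sqrf_eq0 cos2sin2 s1 subrr.
apply: cos_inj; rewrite ?in_itv //=; last by rewrite c0 cos_pihalf.
by apply/andP; split; lra.
Qed.

Lemma sin_le1_sqr (t : R) : 0 <= sin t ^+ 2 <= 1.
Proof. by rewrite sqr_ge0 /= sin2cos2 lerBlDr lerDl sqr_ge0. Qed.

(** The gate scales the Bloch coordinate [y j] by a product [s j] of two sines, whereas a transfer
    preserves the length of the Bloch vector. *)
Lemma gate_transfer_angles (r : 'M[C]_2) (x : R) (c : 'I_3 -> R) m :
  0 < x -> traceless_herm r x -> angle_range c -> transfers r (canonical_gate
      c) m ->
  exists j, forall k, k != j -> c k = pi / 2.
Proof.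
move=> x0 rx cr Gm; have [_ _ mm] := transfers_sqr rx (proj1 (canonical_gate_SU
    c)) Gm.
have [y rE xE] := traceless_herm_pauli rx.
pose s j := sin (c (other1 j)) * sin (c (other2 j)).
have : (\sum_j (y j * s j) ^+ 2)%:C = (x ^+ 2)%:C :> C.
  have := mm; rewrite (transfers_half_bloch Gm) rE gate_half_bloch
      pauli_sum_sqr.
  by move=> /(congr1 (fun A : 'M[C]_2 => A 0 0)); rewrite !mxE !mulr1n.
move=> [sE].
have s01 j : 0 <= s j ^+ 2 <= 1.
  have /andP[a0 a1] := sin_le1_sqr (c (other1 j)).
  have /andP[b0 b1] := sin_le1_sqr (c (other2 j)).
  by rewrite /s exprMn mulr_ge0 //= mulr_ile1.
(* All terms are nonnegative, so each vanishes, and a nonzero coordinate [y j] forces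
   [s j ^+ 2 = 1]. *)
have : \sum_j (y j ^+ 2 * (1 - s j ^+ 2)) = 0.
  rewrite (eq_bigr (fun j => y j ^+ 2 - (y j * s j) ^+ 2)); last by move=> j _;
      ring.
  by rewrite sumrB sE -xE subrr.
move=> /eqP; rewrite psumr_eq0; last first.
  by move=> j _; rewrite mulr_ge0 ?sqr_ge0 // subr_ge0; case/andP: (s01 j).
move=> /allP ys.
have [j yj] : exists j, y j != 0.
  apply/existsP; rewrite -negb_forall; apply/negP => /forallP y0.
  have : 0 < x ^+ 2 by rewrite exprn_gt0.
  by rewrite xE big1 ?ltxx // => j _; rewrite (eqP (y0 j)) expr0n.
exists j.
have /= := ys j (mem_index_enum _); rewrite mulf_eq0 sqrf_eq0 (negbTE yj) /=.
rewrite subr_eq0 => /eqP /esym; rewrite /s exprMn => sj.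
have /andP[a0 a1] := sin_le1_sqr (c (other1 j)).
have /andP[b0 b1] := sin_le1_sqr (c (other2 j)).
move=> k /other_cases[] ->; apply: sin_eq1_range; first [exact: cr | move: a0
    a1 b0 b1 sj].
(* Two numbers in the unit interval with product 1 are both equal to 1. *)
all: move: (_ ^+ 2) (_ ^+ 2) => a b *; nra.
Qed.

End Transfer.

Lemma rot0 (T : comNzRingType) n (b : T) (S : 'M[T]_n) : rot 0 b S = b *: S.
Proof. by rewrite /rot -(scalemx1 _ 0) scale0r add0r. Qed.

(** * Realizable transfers *)

Section ProductVectors.
Variable R : realType.
Local Notation C := R[i].
Local Notation sg := (pauli R).

(* The tensor product of two vectors, typed as a column of height [2 * 2]. *)
Definition tcol (a b : 'cV[C]_2) : 'cV[C]_(2 * 2) :=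
  \col_k (a (mxtens_unindex k).1 0 * b (mxtens_unindex k).2 0).

Lemma tens_tcol (A B : 'M[C]_2) (a b : 'cV[C]_2) :
  (A *t B) *m tcol a b = tcol (A *m a) (B *m b).
Proof.
apply/colP => k; rewrite !mxE big_mxtens big_distrlr /=.
apply: eq_bigr => i _; apply: eq_bigr => j _.
by rewrite !mxE mxtens_indexK /=; ring.
Qed.

Lemma tcolZl (x : C) a b : tcol (x *: a) b = x *: tcol a b.
Proof. by apply/colP => k; rewrite !mxE mulrA. Qed.

Lemma tcolZr (x : C) a b : tcol a (x *: b) = x *: tcol a b.
Proof. by apply/colP => k; rewrite !mxE mulrCA. Qed.

Lemma rdot_tcol a b : rdot (tcol a b) (tcol a b) = rdot a a * rdot b b.
Proof.
rewrite !rdotE big_mxtens big_distrlr /=; apply: eq_bigr => i _.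
apply: eq_bigr => j _; rewrite !mxE mxtens_indexK /=.
by case: (a i 0) => ? ?; case: (b j 0) => ? ? /=; ring.
Qed.

Lemma realizable_transfer_time (J : R) m l T U (r n : 'M[C]_2) (x : R) :
  0 < J -> 0 < x -> traceless_herm r x -> realizable J m l T U ->
  transfers r U n -> pi / (2 * J) <= T.
Proof.
move=> J0 x0 rx UT Un.
have [_ Uu] := realizable_unitary UT; have nx := transfers_sqr rx Uu Un.
have [kS [kB [kSu kBu H]]] := orthogonal_reach_time J0 UT.
(* The sign [- x] makes [eigenvector2] return [a] such that [kS *m a] is an eigenvector of [n] for
   [- x]. *)
have n'x : traceless_herm (kS ^t* *m n *m kS) (- x).
  have := traceless_herm_conj (unitary_adj kSu) nx; rewrite trmxCK.
  by case=> h1 h2 h3; split=> //; rewrite sqrrN.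
have xn0 : x != 0 by rewrite gt_eqF.
have [b b1 rb] := eigenvector2 xn0 rx.
have [|a a1 na] := eigenvector2 _ n'x; first by rewrite oppr_eq0.
apply: (H (tcol a b)); first by rewrite rdot_tcol a1 b1 mulr1.
set u := U *m tcol a b; set v := (kS *t kB) *m tcol a b.
have nu : (n *t 1%:M) *m u = x%:C *: u.
  rewrite /u -Un -!mulmxA (mulmxA (U ^t*)) unitarymxV // mul1mx tens_tcol
      mul1mx.
  by rewrite rb tcolZr scalemxAr.
have nv : (n *t 1%:M) *m v = (- x)%:C *: v.
  rewrite /v !tens_tcol mul1mx -tcolZl scalemxAr -na; congr tcol.
  have := unitarymxP kSu; move: (kS ^t*) => k kk.
  by rewrite !mulmxA kk mul1mx.
have [nh _ _] := nx.
(* The two sides are [x] and [- x] times the overlap of [u] and [v], which is therefore zero. *)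
have : rdot ((n *t 1%:M) *m u) v = rdot u ((n *t 1%:M) *m v).
  by rewrite rdot_mull adj_tens nh adjmx1.
rewrite nu nv rdotZl rdotZr => E.
apply/eqP; rewrite -(mulrI_eq0 _ (lregP xn0)).
by apply/eqP; lra.
Qed.

Lemma unitary_diagonal n (A : 'M[C]_n) : A \is unitarymx ->
  exists (P : 'M[C]_n) (d : 'rV[C]_n), P \is unitarymx /\ A = P ^t* *m diag_mx
      d *m P.
Proof.
move=> Au; have An : A \is normalmx.
  by apply/normalmxP; rewrite unitarymxV // (unitarymxP Au).
have /orthomx_spectralP AE := An.
exists (spectralmx A), (spectral_diag A); split; first exact:
    spectral_unitarymx.
by rewrite [LHS]AE (invmx_unitary (spectral_unitarymx A)).
Qed.

(** After diagonalization the determinant is the product of all pairwise products of eigenvalues,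
    the square of [\det A * \det B]. *)
Lemma SU_tens (A B : 'M[C]_2) : SU A -> SU B -> SU (A *t B).
Proof.
move=> [Au Ad] [Bu Bd]; split; first exact: tens_unitary.
have detE n (P : 'M[C]_n) d : P \is unitarymx ->
    \det (P ^t* *m diag_mx d *m P) = \prod_i d 0 i.
  by move=> Pu; rewrite !det_mulmx mulrAC -det_mulmx unitarymxV // det1 mul1r
      det_diag.
have [P [d [Pu AE]]] := unitary_diagonal Au.
have [Q [f [Qu BE]]] := unitary_diagonal Bu.
have -> : A *t B = (P *t Q) ^t* *m diag_mx (\row_k (d 0 (mxtens_unindex k).1
                      * f 0 (mxtens_unindex k).2)) *m (P *t Q).
  by rewrite AE BE -tensmx_mul -tensmx_mul tens_diag adj_tens.
rewrite detE; last exact: tens_unitary.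
have detA : \prod_i d 0 i = 1 by move: Ad; rewrite AE (detE _ _ _ Pu).
have detB : \prod_i f 0 i = 1 by move: Bd; rewrite BE (detE _ _ _ Qu).
rewrite big_mxtens (eq_bigr (fun i => d 0 i * d 0 i)) => [|i _].
  by rewrite big_split /= detA mulr1.
under eq_bigr do rewrite mxE mxtens_indexK.
rewrite big_split /= detB mulr1; move: (d 0 i) => z.
by rewrite !big_ord_recl big_ord0 mulr1.
Qed.

Lemma tens_conj (a b r s : 'M[C]_2) :
  (a *t b) *m (r *t s) *m (a *t b) ^t* = (a *m r *m a ^t*) *t (b *m s *m b ^t*).
Proof. by rewrite adj_tens !tensmx_mul. Qed.

(** Two pulses of the coupling alone, separated by a local operation. Up to sign, the first takes
    [1 (x) sigma_p] to [sigma_m (x) sigma_q], the local operation turns this into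
    [sigma_p' (x) sigma_l], and the second pulse leaves [sigma_q' (x) 1]. *)
Lemma exists_realizable_transfer (J x : R) (m l : 'I_3) (r : 'M[C]_2) : 0 < J
    -> 0 < x ->
  traceless_herm r x ->
  exists U n, [/\ SU U, transfers r U n & realizable J m l (pi / (2 * J)) U].
Proof.
move=> J0 x0 rx; have xn0 : x != 0 by rewrite gt_eqF.
pose S := sg m *t sg l.
have Sh : S ^t* = S by rewrite adj_tens !pauli_herm.
have SS : S *m S = 1%:M by rewrite tensmx_mul !pauli_sqr tensmx11.
have trS : \tr S = 0 by rewrite tr_tens pauli_tr mul0r.
(* Half of the total time: the pulse angle [J * s = pi / 4] is doubled by conjugation to [pi / 2],
   where the cosine term disappears. *)
pose s := pi / (4 * J).
pose e := irot (- (pi / 2) / 2) S.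
have eE : mexp ((- 'i%C * s%:C) *: hamiltonian J m l (fun=> 0) (fun=> 0)) = e.
  have -> : hamiltonian J m l (fun=> 0) (fun=> 0) = J%:C *: S.
    rewrite /hamiltonian !big1 ?tens0mx ?tensmx0 ?add0r // => k _;
      by rewrite scale0r.
  rewrite (mexp_involution _ _ Sh SS); congr (irot _ S).
  by rewrite /s; field; rewrite gt_eqF.
have eSU : SU e by apply: irot_SU.
have eu := proj1 eSU.
(* [r] is first aligned with [sigma_p], which anticommutes with the ancilla side [sigma_l] of the
   coupling. *)
pose p := other1 l; pose q := other2 l.
have [k1 k1S k1E] := SU2_conj xn0 rx (pauli_traceless_herm p x).
have one0 : (1 : R) != 0 by exact: oner_neq0.
have pth k : traceless_herm (sg k) 1.
  by have := pauli_traceless_herm k (1 : R); rewrite rmorph1 scale1r.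
pose p' := other1 m; pose q' := other2 m.
have [a aS aE] := SU2_conj one0 (pth m) (pth p').
have [b bS bE] := SU2_conj one0 (pth q) (pth l).
have lp : l != p := other1j l.
have pl : p != l by rewrite eq_sym.
have mp : m != p' := other1j m.
have ql : q != l := other2j l.
have qm : q' != m := other2j m.
have [lam _ lamE] : exists2 lam : C, lam * lam = -1 & sg l *m sg p = lam *: sg
    q.
  by apply: pauli_mul; rewrite // eq_sym ?ql // other12.
have [mu _ muE] : exists2 mu : C, mu * mu = -1 & sg m *m sg p' = mu *: sg q'.
  by apply: pauli_mul; rewrite // eq_sym ?qm // other12.
have i1 N : irot (- (pi / 2)) S *m N = - 'i%C *: (S *m N).
  rewrite /irot cosN sinN cos_pihalf sin_pihalf rmorph0 rot0.
  by rewrite rmorphN rmorph1 mulrN1 scalemxAl.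
pose K1 : 'M[C]_(2 * 2) := 1%:M *t k1; pose K2 : 'M[C]_(2 * 2) := a *t b.
exists (e *m (K2 *m (e *m K1))), ((x%:C * (- 'i%C * lam) * (- 'i%C * mu)) *: sg
    q').
have K1SU : SU K1 := SU_tens (SU1 _ _) k1S.
have K2SU : SU K2 := SU_tens aS bS.
split.
- exact: SU_mul eSU (SU_mul K2SU (SU_mul eSU K1SU)).
- rewrite /transfers !conj_mulM.
  have -> : K1 *m (1%:M *t r) *m K1 ^t* = x%:C *: (1%:M *t sg p).
    by rewrite tens_conj k1E mul1mx adjmx1 mulmx1 tensmxZr.
  have conjZ (A N : 'M[C]_(2 * 2)) (y : C) : A *m (y *: N) *m A ^t* = y *: (A
      *m N *m A ^t*).
    by rewrite -scalemxAr -scalemxAl.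
  have anti1 : S *m (1%:M *t sg p) = - ((1%:M *t sg p) *m S).
    by rewrite /S !tensmx_mul mulmx1 mul1mx (pauli_anticomm R lp) tensNr.
  have anti2 : S *m (sg p' *t sg l) = - ((sg p' *t sg l) *m S).
    by rewrite /S !tensmx_mul (pauli_anticomm R mp) tensNl.
  rewrite conjZ (irot_conj_anticomm _ Sh SS anti1) i1 tensmx_mul mulmx1 lamE
      tensmxZr !conjZ tens_conj aE bE.
  rewrite (irot_conj_anticomm _ Sh SS anti2) i1 tensmx_mul pauli_sqr muE
      tensmxZl !scalerA -tensmxZl.
  by congr (_ *: _ *t _); ring.
have sum2 : pi / (2 * J) = 0 + s + s.
  by rewrite /s add0r; field; rewrite gt_eqF.
have s0 : 0 <= s by rewrite /s divr_ge0 ?pi_ge0 // mulr_ge0 // ltW.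
rewrite sum2 -eE; apply: realizable_evolve => //; apply: realizable_local.
  apply: realizable_evolve => //; rewrite -[K1]mulmx1; apply: realizable_local.
    exact: realizable_start.
  by exists 1%:M, k1; split=> //; apply: SU1.
by exists a, b.
Qed.

End ProductVectors.

(** * The minimum reset time *)

Lemma tr_conj_sqr (T : comNzRingType) n (a a' F : 'M[T]_n) : a' *m a = 1%:M ->
  \tr (a *m F *m a' *m (a *m F *m a')) = \tr (F *m F).
Proof.
move=> aa; have -> : a *m F *m a' *m (a *m F *m a') = a *m (F *m F) *m a'.
  by rewrite !mulmxA -(mulmxA _ a' a) aa mulmx1.
by rewrite mxtrace_mulC (mulmxA a') aa mul1mx.
Qed.

(** * Dependence of the purity on the local operations *)

Section ReducedState.
Variable R : realType.
Local Notation C := R[i].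

(** The left factor only conjugates the reduced state by a unitary, and [kS] fixes the maximally
    mixed qubit; what remains is the transformed ancilla state. *)
Lemma qubit_purity_local (rhoB a b kS kB : 'M[C]_2) (G : 'M[C]_(2 * 2))
    (F := ptraceB (G *m initial_state (kB *m rhoB *m kB ^t*) *m G ^t*)) :
  a \is unitarymx -> b \is unitarymx -> kS \is unitarymx ->
  qubit_purity rhoB ((a *t b) *m G *m (kS *t kB)) = complex.Re (\tr (F *m F)).
Proof.
move=> au bu ku; rewrite /qubit_purity.
have -> : final_qubit_state rhoB ((a *t b) *m G *m (kS *t kB)) = a *m F *m a
    ^t*.
  have iE : (kS *t kB) *m initial_state rhoB *m (kS *t kB) ^t*
      = initial_state (kB *m rhoB *m kB ^t*).
    rewrite /initial_state tens_conj; congr (_ *t _).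
    by rewrite scalemx1 mul_mx_scalar -scalemxAl (unitarymxP ku) scalemx1.
  rewrite /final_qubit_state (conj_mulM ((a *t b) *m G)) iE (conj_mulM (a *t
      b)).
  exact: ptraceB_local.
by rewrite (tr_conj_sqr _ (unitarymxV au)).
Qed.

(** The lower off-diagonal entry, absent from the parameters, is the conjugate of the upper one. *)
Lemma ancilla_params_inj (rhoB kB1 kB2 : 'M[C]_2) : rhoB ^t* = rhoB ->
  ancilla_params rhoB kB1 = ancilla_params rhoB kB2 ->
  kB1 *m rhoB *m kB1 ^t* = kB2 *m rhoB *m kB2 ^t*.
Proof.
move=> rh; rewrite /ancilla_params.
have hE (A : 'M[C]_2) : A ^t* = A -> A 1 0 = Num.conj (A 0 1).
  by move=> AE; rewrite -[in LHS]AE !mxE.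
have kh (k : 'M[C]_2) : (k *m rhoB *m k ^t*) ^t* = k *m rhoB *m k ^t*.
  by rewrite adjmx_mul (adjmx_mul k) trmxCK rh mulmxA.
have := hE _ (kh kB1); have := hE _ (kh kB2).
move: (kB1 *m _ *m _) (kB2 *m _ *m _) => A B hB hA [e00 e11 e01].
by apply: matrix2P; rewrite // hA hB e01.
Qed.

End ReducedState.

(** * Angles of the resetting gates *)

Section ResetAngles.
Variables (R : realType) (J : R) (rhoB r : 'M[R[i]]_2) (x : R).
Hypotheses (J0 : 0 < J) (x0 : 0 < x) (rx : traceless_herm r x).
Hypothesis rhoE : rhoB = 2^-1 *: 1%:M + r.
Local Notation C := R[i].
Local Notation sg := (pauli R).

Lemma resets_transfer U : resets rhoB U -> transfers r U (half_bloch r U).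
Proof.
(* Any coupling axes serve here: the gate only witnesses that the purity bound is attained in
   SU(4). *)
have [U0 [n [U0S U0n _]]] := exists_realizable_transfer ord0 ord0 J0 x0 rx.
exact: (resets_transfers rx rhoE U0S U0n).
Qed.

Lemma local_op_SU (K : 'M[C]_(2 * 2)) : local_op K -> SU K.
Proof. by case=> a [b [aS bS ->]]; apply: SU_tens. Qed.

Lemma gate_SU (c : 'I_3 -> R) (K K' : 'M[C]_(2 * 2)) : local_op K -> local_op
    K' ->
  SU (K *m canonical_gate c *m K').
Proof.
move=> /local_op_SU Ks /local_op_SU K's.
exact: SU_mul (SU_mul Ks (canonical_gate_SU c)) K's.
Qed.

(** [kB] aligns the ancilla Bloch vector with the axis [j], which the gate transfers whole to the
    qubit. *)
Lemma half_pi_resets (c : 'I_3 -> R) j : (forall k, k != j -> c k = pi / 2) ->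
  exists2 kB : 'M[C]_2, SU kB &
    forall (K : 'M[C]_(2 * 2)) (kS : 'M[C]_2), local_op K -> SU kS ->
      resets rhoB (K *m canonical_gate c *m (kS *t kB)).
Proof.
move=> cj; have xn0 : x != 0 by rewrite gt_eqF.
have [k kS kE] := SU2_conj xn0 rx (pauli_traceless_herm j x).
exists k => // K a Kl aS.
have gT := gate_transfer x cj; rewrite -{1}kE in gT.
have KG : SU (K *m canonical_gate c *m (a *t k)).
  by apply: gate_SU => //; exists a, k.
have [K1 [K2 [[K1u _] [K2u _] KE]]] := Kl.
apply: (transfers_resets rx rhoE KG (m := K1 *m (x%:C *: sg j) *m K1 ^t*)).
rewrite KE; apply: transfers_right (proj1 aS) _.
exact: transfers_left K2u gT.
Qed.

Lemma resets_half_pi (c : 'I_3 -> R) (K K' : 'M[C]_(2 * 2)) :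
  angle_range c -> local_op K -> local_op K' ->
  resets rhoB (K *m canonical_gate c *m K') ->
  exists j, forall k, k != j -> c k = pi / 2.
Proof.
move=> cr [a [b [[au _] [bu _] ->]]] [a' [b' [[au' _] [bu' _] ->]]].
move=> /resets_transfer /(transfers_strip au bu au' bu').
exact: gate_transfer_angles x0 (traceless_herm_conj bu' rx) cr.
Qed.

Lemma sum_half_pi (c : 'I_3 -> R) j : (forall k, k != j -> c k = pi / 2) ->
  \sum_k c k = pi + c j.
Proof.
move=> cj; rewrite (sum_ord3 _ (other12 j) (other2j j) (other1j j)).
have c1 : c (other1 j) = pi / 2 by apply: cj; rewrite eq_sym other1j.
by rewrite c1 (cj _ (other2j j)) -splitr.
Qed.

Lemma resets_sum_ge_pi U (c : 'I_3 -> R) : resets rhoB U -> has_angles U c ->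
  pi <= \sum_k c k.
Proof.
move=> Ur [cr [K [K' [Kl Kl' UE]]]]; rewrite UE in Ur.
have [j cj] := resets_half_pi cr Kl Kl' Ur.
by rewrite (sum_half_pi cj) lerDl; case/andP: (cr j).
Qed.

Lemma two_half_pi_range (c : 'I_3 -> R) : two_half_pi c -> angle_range c.
Proof.
have pi0 := pi_gt0 R.
move=> [j [cj0 cj]] k; have [->|kj] := eqVneq k j; first by rewrite cj0 lexx
    ltW.
by rewrite cj //; apply/andP; split; lra.
Qed.

(** The angle sum is [pi], the lower bound that holds for every decomposition of a resetting
    gate. *)
Lemma two_half_pi_smallest U (c : 'I_3 -> R) : resets rhoB U -> has_angles U c
    ->
  two_half_pi c -> smallest_angles U c /\ tori_time J (pi / (2 * J)) U.
Proof.
move=> Ur Uc [j [cj0 cj]].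
have sE : \sum_k c k = pi by rewrite (sum_half_pi cj) cj0 addr0.
have sm : smallest_angles U c.
  by split=> // c' Uc'; rewrite sE; apply: resets_sum_ge_pi Uc'.
by split=> //; exists c; rewrite // sE mulrC.
Qed.

End ResetAngles.

Theorem theorem2 (R : realType) (J : R) (m l : 'I_3) (rhoB : 'M[R[i]]_2)
    (J_gt0 : 0 < J) (rhoB_density : density_matrix rhoB)
    (rhoB_not_mixed : rhoB <> 2^-1 *: 1%:M) :
  [/\ is_minimum (reset_times (tori_time J) rhoB) (pi / (2 * J)),
      is_minimum (reset_times (realizable J m l) rhoB) (pi / (2 * J)),
      (forall (c : 'I_3 -> R) (K K' : 'M[R[i]]_(2 * 2)),
         angle_range c -> local_op K -> local_op K' ->
         let U := K *m canonical_gate c *m K' in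
         resets rhoB U ->
         (smallest_angles U c /\ tori_time J (pi / (2 * J)) U
          <-> two_half_pi c)),
      (forall c : 'I_3 -> R, two_half_pi c ->
         exists2 kB : 'M[R[i]]_2, SU kB &
           forall (K : 'M[R[i]]_(2 * 2)) (kS : 'M[R[i]]_2),
             local_op K -> SU kS ->
             resets rhoB (K *m canonical_gate c *m (kS *t kB)%R))
    & (forall (c : 'I_3 -> R) (K1 K2 : 'M[R[i]]_(2 * 2))
              (kS1 kS2 kB1 kB2 : 'M[R[i]]_2),
         angle_range c -> local_op K1 -> local_op K2 ->
         SU kS1 -> SU kS2 -> SU kB1 -> SU kB2 ->
         ancilla_params rhoB kB1 = ancilla_params rhoB kB2 ->
         qubit_purity rhoB (K1 *m canonical_gate c *m (kS1 *t kB1)%R)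
         = qubit_purity rhoB (K2 *m canonical_gate c *m (kS2 *t kB2)%R))].
Proof.
have [r [x [x0 rx rhoE]]] := density_traceless_part rhoB_density rhoB_not_mixed.
have [rh _ _] := rx.
(* Angles of a gate that attains the minimum in the first claim. *)
pose c0 (k : 'I_3) : R := if k == ord0 then 0 else pi / 2.
have c0h : two_half_pi c0.
  by exists ord0; split=> // k k0; rewrite /c0 (negbTE k0).
have one_local : local_op (1%:M : 'M[R[i]]_(2 * 2)).
  by exists 1%:M, 1%:M; rewrite tensmx11; split=> //; apply: SU1.
split.
- split.
    have [j [_ c0j]] := c0h.
    have [kB kBS /(_ 1%:M 1%:M one_local (SU1 _ _)) Ur] := half_pi_resets x0 rx
        rhoE c0j.
    exists (1%:M *m canonical_gate c0 *m (1%:M *t kB)); split=> //.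
    apply: (proj2 (two_half_pi_smallest J_gt0 x0 rx rhoE Ur _ c0h)).
    split; first exact: two_half_pi_range.
    exists 1%:M, (1%:M *t kB); split=> //.
    by exists 1%:M, kB; split=> //; apply: SU1.
  move=> T [U [Ur [c [Uc _] ->]]].
  rewrite mulrC ler_wpM2l ?invr_ge0 ?mulr_ge0 ?(ltW J_gt0) //.
  exact (resets_sum_ge_pi J_gt0 x0 rx rhoE Ur Uc).
- split.
    have [U [n [US Un UT]]] := exists_realizable_transfer m l J_gt0 x0 rx.
    by exists U; split=> //; exact (transfers_resets rx rhoE US Un).
  move=> T [U [Ur UT]].
  apply: (realizable_transfer_time J_gt0 x0 rx UT (resets_transfer J_gt0 x0 rx
      rhoE Ur)).
- move=> c K K' cr Kl Kl' U Ur.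
  have Uc : has_angles U c by split=> //; exists K, K'.
  split; last by move=> ch; exact (two_half_pi_smallest J_gt0 x0 rx rhoE Ur Uc
      ch).
  move=> [[_ cmin] [c' [Uc' _] TE]].
  have [j cj] := resets_half_pi J_gt0 x0 rx rhoE cr Kl Kl' Ur.
  exists j; split=> //.
  (* The time [pi / (2 * J)] gives the angles [c'] the sum [pi], and [c] has the smallest sum; as
     two angles already add up to [pi], the third is zero. *)
  have : \sum_k c k <= pi.
    apply: le_trans (cmin _ Uc') _; move: TE; rewrite [LHS]mulrC => /mulfI <-
        //.
    by rewrite invr_neq0 // mulf_neq0 ?pnatr_eq0 // gt_eqF.
  rewrite (sum_half_pi cj) gerDl => cj0.
  by apply/eqP; rewrite eq_le cj0; case/andP: (cr j).
- move=> c [j [_ cj]].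
  exact (half_pi_resets x0 rx rhoE cj).
move=> c K1 K2 kS1 kS2 kB1 kB2 _ [a1 [b1 [a1S b1S ->]]] [a2 [b2 [a2S b2S ->]]].
move=> kS1S kS2S kB1S kB2S.
have rhoh : rhoB ^t* = rhoB.
  by rewrite rhoE adjmxD adjmxZ adjmx1 rh fmorphV rmorph_nat.
move=> /(ancilla_params_inj rhoh) kE.
rewrite (qubit_purity_local _ _ _ (proj1 a1S) (proj1 b1S) (proj1 kS1S)).
by rewrite (qubit_purity_local _ _ _ (proj1 a2S) (proj1 b2S) (proj1 kS2S)) kE.
Qed.
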